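(* Let $d\in\mathbb{N}$ and let $T$ be a $d$-parameter $C_0$-semigroup over a Hilbert space $\mathcal{H}$ with bounded generators. Then the following are equivalent: (1) $T$ has a regular unitary dilation. (2) $T$ satisfies regular polynomial bounds. (3) $T$ satisfies regular polynomial bounds in a neighbourhood of $\mathbf{0}$.
   Context: Hilbert spaces are complex; $\mathfrak{L}(\mathcal{H})$ and $\mathfrak{L}(\mathcal{H},\mathcal{H}')$ denote bounded operators; $\mathbb{N}=\{1,2,\ldots\}$; $\mathbb{T}=\{z\in\mathbb{C}:|z|=1\}$. A $d$-parameter $C_0$-semigroup over $\mathcal{H}$ is a map $T:\mathbb{R}_{\geq 0}^{d}\to\mathfrak{L}(\mathcal{H})$, continuous for the strong operator topology (SOT), with $T(\mathbf{0})=I$ and $T(\mathbf{s}+\mathbf{t})=T(\mathbf{s})T(\mathbf{t})$. Its marginals are the commuting one-parameter $C_0$-semigroups $T_i(t)=T(t\mathbf{e}_i)$ ($\mathbf{e}_i$ the canonical unit vectors), and its generators are the infinitesimal generators of $T_1,\ldots,T_d$. For $\mathbf{t}\in\mathbb{R}^d$ put $\mathbf{t}^{+}=(\max\{t_i,0\})_i$ and $\mathbf{t}^{-}=(\max\{-t_i,0\})_i$. A regular unitary dilation of $T$ is a tuple $(U,\mathcal{H}',r)$, where $\mathcal{H}'$ is a Hilbert space, $U$ is an SOT-continuous unitary representation of $(\mathbb{R}^d,+,\mathbf{0})$ over $\mathcal{H}'$, and $r\in\mathfrak{L}(\mathcal{H},\mathcal{H}')$ (necessarily isometric), such that $T(\mathbf{t}^{-})^{*}T(\mathbf{t}^{+})=r^{*}U(\mathbf{t})r$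 for all $\mathbf{t}\in\mathbb{R}^d$. Regular polynomial evaluation: for commuting $S_1,\ldots,S_d\in\mathfrak{L}(\mathcal{H})$, the map $p\mapsto p(S_1,\ldots,S_d)$ from $\mathbb{C}[X_1,X_1^{-1},\ldots,X_d,X_d^{-1}]$ to $\mathfrak{L}(\mathcal{H})$ is the unique linear map sending each monomial $\prod_{i=1}^d X_i^{n_i}$, $\mathbf{n}\in\mathbb{Z}^d$, to $\big(\prod_{i:\,n_i<0}S_i^{-n_i}\big)^{*}\big(\prod_{i:\,n_i>0}S_i^{n_i}\big)$. Consider the inequality $$\|p(T_1(t_1),\ldots,T_d(t_d))\|\leq\sup_{\boldsymbol{\lambda}\in\mathbb{T}^d}|p(\lambda_1,\ldots,\lambda_d)|.\qquad(\ast)$$ $T$ satisfies regular polynomial bounds if $(\ast)$ holds for all $p\in\mathbb{C}[X_1,X_1^{-1},\ldots,X_d,X_d^{-1}]$ and all $\mathbf{t}=(t_i)_{i=1}^d\in\mathbb{R}_{\geq 0}^{d}$. $T$ satisfies regular polynomial bounds in a neighbourhood of $\mathbf{0}$ if for some neighbourhood $W\subseteq\mathbb{R}_{\geq 0}^{d}$ of $\mathbf{0}$, $(\ast)$ holds for all such $p$ and all $\mathbf{t}\in W$. *)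

(* Defs.v *)
From HB Require Import structures.
From mathcomp Require Import all_boot all_order all_algebra.
From mathcomp Require Import finmap.
From mathcomp Require Import complex.
From mathcomp Require Import all_classical all_reals all_analysis.

Set Implicit Arguments.
Unset Strict Implicit.
Unset Printing Implicit Defensive.

Import Order.TTheory GRing.Theory Num.Theory.
Import numFieldNormedType.Exports.

Local Open Scope classical_set_scope.
Local Open Scope complex_scope.
Local Open Scope ring_scope.

(* The inner product is linear in its first argument and conjugate-linear in
   its second one. *)
HB.mixin Record NormedModule_isHilbert (R : realType) H
    of NormedModule R[i] H := {
  hdot : {dot H for (@Num.conj R[i])} ;
  hdotE : forall x : H, hdot x x = `|x| ^+ 2
}.

#[short(type="hilbertType")]
HB.structure Definition Hilbert (R : realType) :=
  {H of CompleteNormedModule R[i] H & NormedModule_isHilbert R H}.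

Section Operators.
Context {R : realType}.

(* Norms over R[i] take their values in R[i]. *)
Definition rnorm (V : normedModType R[i]) (x : V) : R := complex.Re `|x|.

Definition bounded_op (H H' : hilbertType R) (A : H -> H') : Prop :=
  linear A /\ exists M : R, forall x, rnorm (A x) <= M * rnorm x.

Definition opnorm (H H' : hilbertType R) (A : H -> H') : R :=
  sup [set rnorm (A x) | x in [set x : H | rnorm x <= 1]].

(* For a bounded operator A the vector z below exists (Riesz) and is unique;
   the default value 0 is only reached when A is not bounded. *)
Definition adjoint (H H' : hilbertType R) (A : H -> H') : H' -> H :=
  fun y => xget 0 [set z : H | forall x, hdot (A x) y = hdot x z].

Definition unitary_op (H : hilbertType R) (A : H -> H) : Prop :=
  [/\ bounded_op A, adjoint A \o A = id & A \o adjoint A = id].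

End Operators.

Section Semigroups.
Context {R : realType} {d : nat}.

Definition orthant : set 'rV[R]_d :=
  [set t : 'rV[R]_d | forall i, 0 <= t 0 i].

Definition pos_part (t : 'rV[R]_d) : 'rV[R]_d :=
  \row_i Num.max (t 0 i) 0.
Definition neg_part (t : 'rV[R]_d) : 'rV[R]_d :=
  \row_i Num.max (- t 0 i) 0.

(* T is a total function for convenience, but only its values on the orthant
   matter: all conditions are restricted to nonnegative parameters. *)
Definition C0_semigroup (H : hilbertType R) (T : 'rV[R]_d -> H -> H) : Prop :=
  [/\ forall t, orthant t -> bounded_op (T t),
      forall x, {within orthant, continuous (T^~ x)},
      T 0 = id
    & forall s t, orthant s -> orthant t -> T (s + t) = T s \o T t].

Definition marginal (H : hilbertType R) (T : 'rV[R]_d -> H -> H) (i : 'I_d)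
  (t : R) : H -> H := T (t *: delta_mx 0 i).

Definition unitary_rep (H : hilbertType R) (U : 'rV[R]_d -> H -> H) : Prop :=
  [/\ forall t, unitary_op (U t),
      forall x, continuous (U^~ x),
      U 0 = id
    & forall s t, U (s + t) = U s \o U t].

Definition regular_unitary_dilation (H : hilbertType R)
    (T : 'rV[R]_d -> H -> H) (H' : hilbertType R)
    (U : 'rV[R]_d -> H' -> H') (r : H -> H') : Prop :=
  [/\ unitary_rep U, bounded_op r
    & forall t, adjoint (T (neg_part t)) \o T (pos_part t)
                = adjoint r \o U t \o r].

Definition has_regular_unitary_dilation (H : hilbertType R)
    (T : 'rV[R]_d -> H -> H) : Prop :=
  exists (H' : hilbertType R) (U : 'rV[R]_d -> H' -> H') (r : H -> H'),
    regular_unitary_dilation T U r.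

End Semigroups.

Section Generators.
Context {R : realType} {H : hilbertType R}.
Implicit Type S : R -> H -> H.

Definition diff_quot S (x : H) (t : R) : H := (t^-1)%:C *: (S t x - x).

Definition gen_dom S : set H := [set x | cvg (diff_quot S x t @[t --> 0^'+])].

Definition generator S (x : H) : H := lim (diff_quot S x t @[t --> 0^'+]).

Definition bounded_generator S : Prop :=
  gen_dom S = setT /\ bounded_op (generator S).

End Generators.

Definition bounded_generators {R : realType} {d : nat} {H : hilbertType R}
    (T : 'rV[R]_d -> H -> H) : Prop :=
  forall i, bounded_generator (marginal T i).

(* A Laurent polynomial in d variables over R[i], as the finitely supported
   family of its coefficients indexed by the exponents in Z^d. *)
Definition laurent (R : realType) (d : nat) :=
  {fsfun 'rV[int]_d -> R[i] with 0}.

Section Evaluation.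
Context {R : realType} {d : nat}.

Definition laurent_eval (p : laurent R d) (l : 'rV[R[i]]_d) : R[i] :=
  \sum_(n <- finsupp p) p n * \prod_i (l 0 i) ^ (n 0 i).

Definition torus : set 'rV[R[i]]_d := 
  [set l : 'rV[R[i]]_d | forall i, `|l 0 i| = 1].

Definition laurent_sup (p : laurent R d) : R :=
  sup [set complex.Re `|laurent_eval p l| | l in torus].

(* The order of composition is immaterial since the S i commute in all uses. *)
Definition regular_monomial (H : hilbertType R) (S : 'I_d -> H -> H)
    (n : 'rV[int]_d) : H -> H :=
  adjoint (\big[comp/id]_(i | (n 0 i < 0)%R) iter (absz (n 0 i)) (S i))
  \o \big[comp/id]_(i | (0 < n 0 i)%R) iter (absz (n 0 i)) (S i).

Definition regular_eval (H : hilbertType R) (p : laurent R d)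
    (S : 'I_d -> H -> H) : H -> H :=
  fun x => \sum_(n <- finsupp p) p n *: regular_monomial S n x.

Definition regular_poly_bound_at (H : hilbertType R) (T : 'rV[R]_d -> H -> H)
    (t : 'rV[R]_d) : Prop :=
  forall p : laurent R d,
    opnorm (regular_eval p (fun i => marginal T i (t 0 i))) <= laurent_sup p.

Definition regular_poly_bounds (H : hilbertType R) (T : 'rV[R]_d -> H -> H) :=
  forall t, orthant t -> regular_poly_bound_at T t.

Definition regular_poly_bounds_near0 (H : hilbertType R)
    (T : 'rV[R]_d -> H -> H) :=
  exists W : set 'rV[R]_d,
    [/\ W `<=` orthant, within orthant (nbhs (0 : 'rV[R]_d)) W
      & forall t, W t -> regular_poly_bound_at T t].

End Evaluation.

(* Main.v *)
Require Import Defs.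
From HB Require Import structures.
From mathcomp Require Import all_boot all_order all_algebra.
From mathcomp Require Import cyclic separable cyclotomic.
From mathcomp Require Import finmap complex.
From mathcomp Require Import all_classical all_reals all_analysis.
From mathcomp Require Import ring lra zify.

(** Write Phi(s) = T(s^-)^* T(s^+) for s in R^d.  A regular unitary dilation
    exists exactly when Phi is positive definite, that is, when
    sum_(j,k) <Phi(s_j - s_k) x_j, x_k> >= 0 for all finite families, and the
    polynomial bounds say the same thing along the lattices
    { n t : n in Z^d }.  The bridge between the two is harmonic analysis on
    the torus, which is the dual group of Z^d.

    Fejer positivity ([fejer_pos]).  Suppose that a finite family of functions
    a_j on Z^d and exponents n_j has sum_j l^(n_j) (Fejer sum of a_j at l)
    with nonnegative real part at every point l of the torus.  Averaging over
    a fine enough grid of roots of unity isolates the coefficient at n_j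
    weighted by the number of ways of writing n_j as a difference of two
    points of a box, and this weight, divided by the size of the box, tends
    to 1.  Hence Re (sum_j a_j(n_j)) >= 0.

    Dilation implies bounds.  After compressing by r it is enough to bound
    p(V) for the commuting unitaries V_i = U(t_i e_i).  The Fejer sums of
    n |-> <V^n v, v> are squared norms, hence nonnegative, and so are their
    products with (sup |p|)^2 - |p(l)|^2.  Fejer positivity turns this into
    |p(V) v|^2 <= (sup |p|)^2 |v|^2 ([unitary_von_neumann]).

    Bounds near 0 imply positivity.  If f is a trigonometric polynomial with
    0 <= f <= M on the torus, the bound applied to f - M/2 gives
    |f(T) - M/2| <= M/2, so Re <f(T) y, y> >= 0 ([bound_positive]).  Taking
    for f the squared modulus of a box sum and applying Fejer positivity
    once more shows that n |-> Phi(n t) is positive definite on Z^d, for each t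
    in the neighbourhood ([lattice_positive]).  With t = (1/N, ..., 1/N) the
    lattices Z^d / N fill R^d as N grows, and Phi is weakly continuous, so Phi
    is positive definite on R^d ([regular_pair_positive]).

    Positivity implies dilation.  The kernel ((s,x),(t,y)) |-> <Phi(t - s) y, x>
    is positive semidefinite, and its reproducing kernel Hilbert space carries
    the dilation: R^d acts by translating the first argument and x is sent to
    the kernel function at (0,x) ([positive_dilation]).

    The Hilbert space of a kernel k on X is obtained without quotient or
    completion: its elements are the functions f : X -> C that are bounded as
    functionals on finite combinations l of points of X, with squared norm
    sup_l (2 Re f(l) - |l|^2).  The same construction for the Gram kernel
    <y, x> of a Hilbert space yields the Riesz representation theorem
    ([riesz]), which provides the adjoints. *)

Set Implicit Arguments.
Unset Strict Implicit.
Unset Printing Implicit Defensive.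

Import Order.TTheory GRing.Theory Num.Theory.
Import numFieldNormedType.Exports.
Local Open Scope classical_set_scope.
Local Open Scope complex_scope.
Local Open Scope ring_scope.

(** * Complex numbers through their real parts *)

Section ComplexParts.
Context {R : realType}.
Implicit Types z w : R[i].

Lemma ReD z w : complex.Re (z + w) = complex.Re z + complex.Re w.
Proof. by case: z w => [a b] [c d]. Qed.
Lemma ReN z : complex.Re (- z) = - complex.Re z.
Proof. by case: z. Qed.
Lemma ReB z w : complex.Re (z - w) = complex.Re z - complex.Re w.
Proof. by rewrite ReD ReN. Qed.
Lemma Re_sum (I : Type) (r : seq I) (P : pred I) (F : I -> R[i]) :
  complex.Re (\sum_(i <- r | P i) F i) = \sum_(i <- r | P i) complex.Re (F i).
Proof. exact: (big_morph _ ReD). Qed.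
Lemma ReZ (a : R) z : complex.Re (a%:C * z) = a * complex.Re z.
Proof. by case: z => b c /=; rewrite mul0r subr0. Qed.
Lemma ReJ z : complex.Re (Num.conj z) = complex.Re z.
Proof. by case: z. Qed.
Lemma ReMn z n : complex.Re (z *+ n) = complex.Re z *+ n.
Proof. by elim: n => // n IH; rewrite !mulrS ReD IH. Qed.
Lemma ReiM z : complex.Re ('i%C * z) = - complex.Im z.
Proof. by case: z => a b /=; ring. Qed.
Lemma Re_le_norm z : complex.Re z <= complex.Re `|z|.
Proof.
have := normc_ge_Re z; rewrite lecE /= => /andP[_]; apply: le_trans; exact: ler_norm.
Qed.
Lemma norm_Re z : `|z| = (complex.Re `|z|)%:C.
Proof. by rewrite normc_def. Qed.
Lemma Re_norm_ge0 z : 0 <= complex.Re `|z|.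
Proof. by rewrite -ler0c -norm_Re. Qed.
Lemma conj_mul_norm z : Num.conj z * z = ((complex.Re `|z|) ^+ 2)%:C.
Proof. by rewrite mulrC -normCK rmorphXn /= -norm_Re. Qed.
Lemma complex_eqP z w : complex.Re z = complex.Re w ->
  complex.Im z = complex.Im w -> z = w.
Proof. by case: z w => [a b] [c d] /= -> ->. Qed.

(** A phase turns bounds on real parts into bounds on moduli. *)
Lemma unimodular_conj_mul z : exists2 u, `|u| = 1 & Num.conj u * z = `|z|.
Proof.
have [->|z0] := eqVneq z 0; first by exists 1; rewrite ?normr1// mulr0 normr0.
exists (z / `|z|); first by rewrite normrM normfV normr_id divff// normr_eq0.
rewrite rmorphM fmorphV /= conj_normC mulrAC [_^* * z]mulrC -normCK expr2 mulfK//.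
by rewrite normr_eq0.
Qed.
End ComplexParts.

(** * Positive semidefinite kernels and the dual norm they define *)

Section Kernel.
Context {R : realType} {X : Type}.
Local Notation C := (R[i]).

(** Finite formal combinations of points.  Repeated points are allowed, as
    combinations only matter through [ev] and [synth]. *)
Definition combo := seq (C * X).

Definition scale_combo (a : C) (l : combo) : combo :=
  [seq (a * p.1, p.2) | p <- l].

(** Conjugate-linear in the combination, so that it becomes the inner product
    of f with [synth l] in the Hilbert space of the kernel. *)
Definition ev (f : X -> C) (l : combo) : C :=
  \sum_(p <- l) Num.conj p.1 * f p.2.

(** The sum in [kernel_psd] is real by symmetry, so its real part is all that
    has to be constrained. *)
Record psd_kernel := PsdKernel {
  kernel_fun :> X -> X -> C;
  kernel_sym : forall x y, kernel_fun y x = Num.conj (kernel_fun x y);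
  kernel_psd : forall l : combo, 0 <= complex.Re
    (\sum_(p <- l) \sum_(q <- l) Num.conj p.1 * (q.1 * kernel_fun p.2 q.2))
}.

Lemma ev_cat f l m : ev f (l ++ m) = ev f l + ev f m.
Proof. by rewrite /ev big_cat. Qed.
Lemma ev_scale f a l : ev f (scale_combo a l) = Num.conj a * ev f l.
Proof.
rewrite /ev big_map mulr_sumr; apply: eq_bigr => p _ /=.
by rewrite rmorphM mulrA.
Qed.
Lemma evD (f g : X -> C) l : ev (f + g) l = ev f l + ev g l.
Proof. by rewrite /ev -big_split; apply: eq_bigr => p _; exact: mulrDr. Qed.
Lemma evZ a (f : X -> C) l : ev (a *: f) l = a * ev f l.
Proof.
by rewrite /ev mulr_sumr; apply: eq_bigr => p _; rewrite mulrCA.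
Qed.
Lemma evN (f : X -> C) l : ev (- f) l = - ev f l.
Proof. by rewrite -scaleN1r evZ mulN1r. Qed.
Lemma evB (f g : X -> C) l : ev (f - g) l = ev f l - ev g l.
Proof. by rewrite evD evN. Qed.

Variable k : psd_kernel.

Definition synth (l : combo) : X -> C := fun x => \sum_(p <- l) p.1 * k x p.2.

Lemma synth_cat l m : synth (l ++ m) = synth l + synth m.
Proof. by apply/funext => x; rewrite /synth big_cat. Qed.
Lemma synth_scale a l : synth (scale_combo a l) = a *: synth l.
Proof.
apply/funext => x; rewrite -[RHS]/(a * synth l x) /synth big_map mulr_sumr.
by apply: eq_bigr => p _; rewrite mulrA.
Qed.
Lemma ev_synthC l m : ev (synth m) l = Num.conj (ev (synth l) m).
Proof.
rewrite /ev rmorph_sum /=.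
under eq_bigr do rewrite /synth mulr_sumr.
rewrite exchange_big; apply: eq_bigr => p _ /=.
rewrite rmorphM /= conjCK /synth rmorph_sum mulr_sumr; apply: eq_bigr => q _ /=.
by rewrite rmorphM /= -kernel_sym mulrCA.
Qed.

(** The squared seminorm that the kernel gives to formal combinations. *)
Definition energy (l : combo) : R := complex.Re (ev (synth l) l).

Lemma energy_ge0 l : 0 <= energy l.
Proof.
rewrite /energy /ev; apply: le_trans (kernel_psd k l) _.
by under eq_bigr do rewrite -mulr_sumr.
Qed.
Lemma energy_cat l m :
  energy (l ++ m) = energy l + energy m + 2 * complex.Re (ev (synth l) m).
Proof.
rewrite /energy synth_cat ev_cat !evD (ev_synthC l m) !ReD ReJ.
by rewrite mulr_natl mulr2n; ring.
Qed.
Lemma energy_scale a l : energy (scale_combo a l) = (complex.Re `|a|) ^+ 2 * energy l.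
Proof. by rewrite /energy synth_scale ev_scale evZ mulrA conj_mul_norm ReZ. Qed.

(** Optimizing over multiples of l shows that sup_l (2 Re f(l) - |l|^2) is the
    square of the norm of f as a functional on combinations.  In this form the
    dual norm behaves exactly, and not just up to estimates, under translation
    of l: see [gap_sub_synth]. *)
Definition dual_gap (f : X -> C) (l : combo) : R :=
  2 * complex.Re (ev f l) - energy l.

Definition dual_bounded (f : X -> C) := has_ubound (range (dual_gap f)).

Definition dual_norm2 (f : X -> C) : R := sup (range (dual_gap f)).

Lemma dual_gap_nil f : dual_gap f [::] = 0.
Proof. by rewrite /dual_gap /energy /ev !big_nil /= mulr0 subr0. Qed.

Lemma gap_ub f l : dual_bounded f -> dual_gap f l <= dual_norm2 f.
Proof. by move=> bf; apply: ub_le_sup => //; exists l. Qed.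

Lemma dual_norm2_le f M : (forall l, dual_gap f l <= M) -> dual_norm2 f <= M.
Proof.
by move=> h; apply: ge_sup => [|_ [l _ <-]]//; exists (dual_gap f [::]), [::].
Qed.

Lemma dual_boundedP f M : (forall l, dual_gap f l <= M) -> dual_bounded f.
Proof. by move=> h; exists M => _ [l _ <-]. Qed.

Lemma dual_norm2_ge0 f : dual_bounded f -> 0 <= dual_norm2 f.
Proof. by move/(gap_ub [::]); rewrite dual_gap_nil. Qed.

Lemma gap_scale a f l : dual_gap (a *: f) (scale_combo a l) =
  (complex.Re `|a|) ^+ 2 * dual_gap f l.
Proof.
by rewrite /dual_gap ev_scale evZ mulrA conj_mul_norm ReZ energy_scale; ring.
Qed.

Lemma sqr_Re_norm_gt0 (a : C) : a != 0 -> 0 < (complex.Re `|a|) ^+ 2.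
Proof. by move=> a0; rewrite exprn_gt0// -ltcR -norm_Re normr_gt0. Qed.

Lemma gap_scaleV a f l : a != 0 -> dual_gap (a *: f) l =
  (complex.Re `|a|) ^+ 2 * dual_gap f (scale_combo a^-1 l).
Proof.
move=> a0; rewrite -gap_scale; congr dual_gap.
rewrite /scale_combo -map_comp -[LHS]map_id; apply: eq_map => -[c x] /=.
by rewrite mulrA divff// mul1r.
Qed.

Lemma dual_gap0_le l : dual_gap 0 l <= 0.
Proof.
rewrite /dual_gap -(scale0r 0) evZ mul0r mulr0 sub0r oppr_le0; exact: energy_ge0.
Qed.

Lemma dual_bounded0 : dual_bounded 0.
Proof. exact: (@dual_boundedP _ 0 dual_gap0_le). Qed.

Lemma dual_boundedZ a f : dual_bounded f -> dual_bounded (a *: f).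
Proof.
move=> bf; have [->|a0] := eqVneq a 0; first by rewrite scale0r; exact: dual_bounded0.
apply: (@dual_boundedP _ ((complex.Re `|a|) ^+ 2 * dual_norm2 f)) => l.
by rewrite gap_scaleV// ler_wpM2l ?sqr_ge0// gap_ub.
Qed.

Lemma dual_norm2Z a f : dual_bounded f ->
  dual_norm2 (a *: f) = (complex.Re `|a|) ^+ 2 * dual_norm2 f.
Proof.
have le_dual_norm2Z b g : b != 0 -> dual_bounded g ->
    dual_norm2 (b *: g) <= (complex.Re `|b|) ^+ 2 * dual_norm2 g.
  move=> b0 bg; apply: dual_norm2_le => l.
  by rewrite gap_scaleV// ler_wpM2l ?sqr_ge0// gap_ub.
move=> bf; have [->|a0] := eqVneq a 0.
  rewrite scale0r normr0 expr0n mul0r; apply/eqP.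
  rewrite eq_le dual_norm2_ge0 ?andbT; last exact: dual_bounded0.
  exact: dual_norm2_le dual_gap0_le.
apply/eqP; rewrite eq_le le_dual_norm2Z//=.
have := le_dual_norm2Z a^-1 (a *: f) _ (dual_boundedZ a bf).
rewrite scalerA mulVf// scale1r invr_eq0 => /(_ a0).
rewrite normfV norm_Re -(fmorphV (real_complex R)) /= exprVn mulrC.
by rewrite ler_pdivlMr ?sqr_Re_norm_gt0// mulrC.
Qed.

Lemma dual_norm2N f : dual_bounded f -> dual_norm2 (- f) = dual_norm2 f.
Proof. by move=> bf; rewrite -scaleN1r dual_norm2Z// normrN1 /= expr1n mul1r. Qed.

Lemma dual_boundedN f : dual_bounded f -> dual_bounded (- f).
Proof. by rewrite -scaleN1r; exact: dual_boundedZ. Qed.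

(** A quadratic polynomial in t that never exceeds n has a controlled
    discriminant; this is the common source of the Cauchy-Schwarz inequalities
    below. *)
Lemma sqr_bound (b q n : R) : 0 <= q -> 0 <= n ->
  (forall t, 2 * t * b - t ^+ 2 * q <= n) -> b <= Num.sqrt n * Num.sqrt q.
Proof.
move=> q0 n0 h; have [b0|b0] := leP b 0.
  by apply: le_trans b0 _; rewrite mulr_ge0// sqrtr_ge0.
rewrite -sqrtrM// -[leLHS](ger0_norm (ltW b0)) -sqrtr_sqr.
rewrite ler_sqrt ?mulr_ge0//.
have [q00|q00] := eqVneq q 0.
  have := h ((n + 1) / b); rewrite q00 mulr0 subr0 -mulrA divfK ?gt_eqF//.
  by move=> ?; exfalso; lra.
have qp : 0 < q by rewrite lt_def q00.
have := h (b / q).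
have -> : 2 * (b / q) * b - (b / q) ^+ 2 * q = b ^+ 2 / q by field.
by rewrite ler_pdivrMr.
Qed.

Lemma ev_le f l : dual_bounded f ->
  complex.Re (ev f l) <= Num.sqrt (dual_norm2 f) * Num.sqrt (energy l).
Proof.
move=> bf; apply: sqr_bound => [||t]; [exact: energy_ge0|exact: dual_norm2_ge0|].
apply: le_trans (gap_ub (scale_combo t%:C l) bf).
rewrite /dual_gap ev_scale energy_scale conj_Creal; last first.
  by apply/complex_realP; exists t.
rewrite ReZ mulrA lerB// normc_def /= expr0n addr0 sqrtr_sqr.
by rewrite real_normK ?num_real.
Qed.

Lemma ev_norm_le f l : dual_bounded f ->
  complex.Re `|ev f l| <= Num.sqrt (dual_norm2 f) * Num.sqrt (energy l).
Proof.
move=> bf; have [u u1 uz] := unimodular_conj_mul (ev f l).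
have := ev_le (scale_combo u l) bf.
by rewrite ev_scale uz energy_scale u1 /= expr1n mul1r.
Qed.

Lemma gapD_le f g l : dual_bounded f -> dual_bounded g ->
  dual_gap (f + g) l <= (Num.sqrt (dual_norm2 f) + Num.sqrt (dual_norm2 g)) ^+ 2.
Proof.
move=> bf bg; rewrite /dual_gap evD ReD.
have := ev_le l bf; have := ev_le l bg.
have -> : energy l = Num.sqrt (energy l) ^+ 2 by rewrite sqr_sqrtr// energy_ge0.
rewrite [Num.sqrt (_ ^+ 2)]sqrtr_sqr ger0_norm ?sqrtr_ge0//.
set a := Num.sqrt (dual_norm2 f); set b := Num.sqrt (dual_norm2 g); set q := Num.sqrt _.
have := sqr_ge0 (a + b - q); nra.
Qed.

Lemma dual_boundedD f g : dual_bounded f -> dual_bounded g -> dual_bounded (f + g).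
Proof. by move=> bf bg; apply: dual_boundedP => l; exact: gapD_le. Qed.

Lemma dual_boundedB f g : dual_bounded f -> dual_bounded g -> dual_bounded (f - g).
Proof. by move=> bf bg; apply: dual_boundedD => //; exact: dual_boundedN. Qed.

Lemma dual_norm_leD f g : dual_bounded f -> dual_bounded g ->
  Num.sqrt (dual_norm2 (f + g)) <= Num.sqrt (dual_norm2 f) + Num.sqrt (dual_norm2 g).
Proof.
move=> bf bg; rewrite -[leRHS]ger0_norm ?addr_ge0 ?sqrtr_ge0// -sqrtr_sqr.
by rewrite ler_wsqrtr//; apply: dual_norm2_le => l; exact: gapD_le.
Qed.

Lemma dual_norm2_eq0 f : dual_bounded f -> dual_norm2 f = 0 -> f = 0.
Proof.
move=> bf f0; apply/funext => x.
have := ev_norm_le [:: (1, x)] bf; rewrite f0 sqrtr0 mul0r /ev big_seq1 /=.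
rewrite rmorph1 mul1r => fx; apply/eqP; rewrite -normr_eq0 norm_Re.
by rewrite (_ : complex.Re _ = 0)//; apply/eqP; rewrite eq_le fx Re_norm_ge0.
Qed.

Lemma gap_sub_synth f l m :
  dual_gap (f - synth l) m = dual_gap f (m ++ l) - dual_gap f l.
Proof.
rewrite /dual_gap evB ReB ev_cat ReD energy_cat.
by rewrite (ev_synthC l m) ReJ; ring.
Qed.

Lemma dual_gap_synth_le l m : dual_gap (synth l) m <= energy l.
Proof.
have := energy_ge0 (scale_combo (-1) m ++ l).
rewrite energy_cat energy_scale normrN1 /= expr1n mul1r ev_synthC ReJ.
rewrite ev_scale rmorphN1 mulN1r ReN /dual_gap; lra.
Qed.

Lemma dual_bounded_synth l : dual_bounded (synth l).
Proof. exact: dual_boundedP (dual_gap_synth_le l). Qed.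

Lemma dual_norm2_synth l : dual_norm2 (synth l) = energy l.
Proof.
apply/eqP; rewrite eq_le; apply/andP; split.
  exact: dual_norm2_le (dual_gap_synth_le l).
apply: le_trans (gap_ub l (dual_bounded_synth l)).
rewrite /dual_gap /energy; lra.
Qed.

(** The supremum that defines the norm of f falls short at l by exactly the
    squared distance from f to [synth l], so near-maximizers approximate f. *)
Lemma dual_norm2_sub_synth f l : dual_bounded f ->
  dual_norm2 (f - synth l) = dual_norm2 f - dual_gap f l.
Proof.
move=> bf; have bl := dual_bounded_synth l.
apply/eqP; rewrite eq_le; apply/andP; split.
  by apply: dual_norm2_le => m; rewrite gap_sub_synth lerB// gap_ub.
rewrite lerBlDr; apply: dual_norm2_le => m.
have := gap_ub (m ++ scale_combo (-1) l) (dual_boundedB bf bl).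
rewrite gap_sub_synth lerBlDr; apply: le_trans.
rewrite /dual_gap !(ev_cat, energy_cat, synth_cat, evD, evB) !energy_scale.
rewrite !(synth_scale, ev_scale, evZ, rmorphN1) normrN1.
rewrite !(ReD, mulN1r, ReN) (ev_synthC l m) ReJ /= expr1n mul1r.
rewrite -!/(energy _); lra.
Qed.

Lemma synth_dense f (e : R) : dual_bounded f -> 0 < e ->
  exists l, Num.sqrt (dual_norm2 (f - synth l)) < e.
Proof.
move=> bf e0; have hs : has_sup (range (dual_gap f)).
  by split => //; exists (dual_gap f [::]), [::].
have [_ [l _ <-] hl] := sup_adherent (exprn_gt0 2 e0) hs; exists l.
rewrite -[ltRHS]ger0_norm ?ltW// -sqrtr_sqr ltr_sqrt ?exprn_gt0//.
by rewrite dual_norm2_sub_synth// /dual_norm2; lra.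
Qed.

(** Polarization.  Additivity does not show in this formula; it comes from
    [rdot_approx]. *)
Definition rdot (f g : X -> C) : R := (dual_norm2 (f + g) - dual_norm2 (f - g)) / 4.

Lemma rdot_CS f g : dual_bounded f -> dual_bounded g ->
  `|rdot f g| <= Num.sqrt (dual_norm2 f) * Num.sqrt (dual_norm2 g).
Proof.
move=> bf bg.
set a := Num.sqrt (dual_norm2 f); set b := Num.sqrt (dual_norm2 g).
have up h h' : dual_bounded h -> dual_bounded h' ->
    dual_norm2 (h + h') <= (Num.sqrt (dual_norm2 h) + Num.sqrt (dual_norm2 h')) ^+ 2.
  by move=> bh bh'; apply: dual_norm2_le => l; exact: gapD_le.
have lo h h' : dual_bounded h -> dual_bounded h' ->
    (Num.sqrt (dual_norm2 h) - Num.sqrt (dual_norm2 h')) ^+ 2 <= dual_norm2 (h + h').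
  move=> bh bh'; have bs := dual_boundedD bh bh'.
  rewrite -[leRHS]sqr_sqrtr ?dual_norm2_ge0//.
  have h1 := dual_norm_leD bs (dual_boundedN bh').
  have h2 := dual_norm_leD bs (dual_boundedN bh).
  rewrite addrK dual_norm2N// in h1; rewrite [h + h']addrC addrK dual_norm2N// in h2.
  rewrite [h' + h]addrC in h2.
  rewrite -ler_sqrt ?sqr_ge0// !sqrtr_sqr [leRHS]ger0_norm ?sqrtr_ge0//.
  by rewrite ler_norml; apply/andP; split; lra.
have h1 := up _ _ bf bg; have h2 := up _ _ bf (dual_boundedN bg).
have h3 := lo _ _ bf bg; have h4 := lo _ _ bf (dual_boundedN bg).
move: h1 h2 h3 h4; rewrite dual_norm2N// -/a -/b /rdot ler_norml => *.
by apply/andP; split; lra.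
Qed.

(** With [synth l] in place of f the inner product is evaluation at l, which is
    linear in g.  The error vanishes as [synth l] tends to f, so linearity
    survives in the limit. *)
Lemma rdot_approx f g l : dual_bounded f -> dual_bounded g ->
  `|rdot f g - complex.Re (ev g l)| <=
  Num.sqrt (dual_norm2 (f - synth l)) * Num.sqrt (dual_norm2 g).
Proof.
move=> bf bg; have bl := dual_bounded_synth l.
have [bD bB] := (dual_boundedD bf bg, dual_boundedB bf bg).
rewrite (_ : _ - _ = rdot (f - synth l) g); first exact/rdot_CS/bg/dual_boundedB.
rewrite /rdot addrAC dual_norm2_sub_synth//.
rewrite [f - synth l - g]addrAC dual_norm2_sub_synth//.
by rewrite /dual_gap evD evB ReD ReB; field.
Qed.

Lemma rdot_unique f g (a K : R) : dual_bounded f -> dual_bounded g -> 0 <= K ->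
  (forall l, `|a - complex.Re (ev g l)| <= Num.sqrt (dual_norm2 (f - synth l)) * K) ->
  rdot f g = a.
Proof.
move=> bf bg K0 h; apply/eqP; rewrite -subr_eq0 -normr_le0.
have KK : 0 < K + Num.sqrt (dual_norm2 g) + 1 by rewrite ltr_wpDl// addr_ge0// sqrtr_ge0.
apply/ler_addgt0Pl => e e0; rewrite addr0.
have [l hl] := synth_dense bf (divr_gt0 e0 KK).
have h1 := h l; have h2 := rdot_approx l bf bg.
have -> : rdot f g - a = (rdot f g - complex.Re (ev g l)) - (a - complex.Re (ev g l)).
  by ring.
apply: le_trans (ler_normB _ _) _; apply: le_trans (lerD h2 h1) _.
rewrite -mulrDr; apply: (@le_trans _ _ (e / (K + Num.sqrt (dual_norm2 g) + 1) *
  (Num.sqrt (dual_norm2 g) + K))).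
  by apply: ler_wpM2r; [rewrite addr_ge0// sqrtr_ge0|exact: ltW].
rewrite mulrAC ler_pdivrMr// ler_wpM2l ?ltW//; lra.
Qed.

Lemma rdotC f g : dual_bounded f -> dual_bounded g -> rdot f g = rdot g f.
Proof.
move=> bf bg; rewrite /rdot [f + g]addrC -[f - g]opprB dual_norm2N//.
exact: dual_boundedB.
Qed.

Lemma rdotDr f g h : dual_bounded f -> dual_bounded g -> dual_bounded h ->
  rdot f (g + h) = rdot f g + rdot f h.
Proof.
move=> bf bg bh.
apply: (@rdot_unique _ _ _ (Num.sqrt (dual_norm2 g) + Num.sqrt (dual_norm2 h))) => //.
  exact: dual_boundedD.
move=> l; rewrite evD ReD opprD addrACA mulrDr.
by apply: le_trans (ler_normD _ _) _; rewrite lerD// rdot_approx.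
Qed.

Lemma rdotZr f g (c : R) : dual_bounded f -> dual_bounded g ->
  rdot f (c%:C *: g) = c * rdot f g.
Proof.
move=> bf bg; apply: (@rdot_unique _ _ _ (`|c| * Num.sqrt (dual_norm2 g))) => //.
  exact: dual_boundedZ.
move=> l; rewrite evZ ReZ -mulrBr normrM mulrCA ler_wpM2l//.
exact: rdot_approx.
Qed.

Lemma rdotNr f g : dual_bounded f -> dual_bounded g -> rdot f (- g) = - rdot f g.
Proof. by move=> bf bg; rewrite -scaleN1r -(rmorphN1 (real_complex R)) rdotZr// mulN1r. Qed.

Lemma rdot_self f : dual_bounded f -> rdot f f = dual_norm2 f.
Proof.
move=> bf; rewrite /rdot subrr -mulr2n -scaler_nat dual_norm2Z//.
have -> : dual_norm2 0 = 0.
  by rewrite -(scale0r f) dual_norm2Z// normr0 expr0n mul0r.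
rewrite subr0 (_ : (2%:R : C) = 2%:C); last by rewrite rmorph_nat.
rewrite normc_def /= expr0n addr0 sqrtr_sqr ger0_norm//; by field.
Qed.

Lemma rdotii f g : dual_bounded f -> dual_bounded g ->
  rdot ('i%C *: f) ('i%C *: g) = rdot f g.
Proof.
move=> bf bg; rewrite /rdot -scalerDr -scalerBr !dual_norm2Z;
  [|exact: dual_boundedB|exact: dual_boundedD].
by rewrite normc_def /= expr0n expr1n add0r sqrtr1 expr1n !mul1r.
Qed.

Lemma rdot_synth f l : dual_bounded f -> rdot (synth l) f = complex.Re (ev f l).
Proof.
move=> bf; have := rdot_approx l (dual_bounded_synth l) bf.
rewrite subrr -(scale0r f) dual_norm2Z// normr0 expr0n mul0r sqrtr0 mul0r normr_le0.
by rewrite subr_eq0 => /eqP.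
Qed.

End Kernel.

(** * The Hilbert space of a kernel *)

Section Rkhs.
Context {R : realType} {X : Type}.
Local Notation C := (R[i]).
Variable k : psd_kernel (R := R) (X := X).

Definition dual_boundedb : {pred X -> C} := fun f => `[< dual_bounded k f >].

Record rkhs := Rkhs { rkhs_fun :> X -> C; rkhs_bounded : rkhs_fun \in dual_boundedb }.

HB.instance Definition _ := [isSub for rkhs_fun].
HB.instance Definition _ := [Choice of rkhs by <:].

Lemma dual_bounded_submod : GRing.subsemimod_closed dual_boundedb.
Proof.
split; first split.
- by apply/asboolP; exact: dual_bounded0.
- by move=> f g /asboolP bf /asboolP bg; apply/asboolP; exact: dual_boundedD.
- by move=> a f /asboolP bf; apply/asboolP; exact: dual_boundedZ.
Qed.

HB.instance Definition _ :=
  GRing.SubChoice_isSubLmodule.Build C (X -> C) dual_boundedb rkhs dual_bounded_submod.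

Lemma rkhsP (f : rkhs) : dual_bounded k f.
Proof. exact/asboolP/rkhs_bounded. Qed.

Lemma rkhsZ (a : C) (f : rkhs) : (a *: f : rkhs) = a *: (f : X -> C) :> (X -> C).
Proof. by []. Qed.

Definition rkhs_norm (f : rkhs) : C := (Num.sqrt (dual_norm2 k f))%:C.

Lemma rkhs_ler_normD f g : rkhs_norm (f + g) <= rkhs_norm f + rkhs_norm g.
Proof.
rewrite /rkhs_norm -(rmorphD (real_complex R)) lecR.
exact: (dual_norm_leD (rkhsP f) (rkhsP g)).
Qed.
Lemma rkhs_normrZ a f : rkhs_norm (a *: f) = `|a| * rkhs_norm f.
Proof.
rewrite /rkhs_norm rkhsZ (dual_norm2Z a (rkhsP f)) sqrtrM ?sqr_ge0//.
rewrite sqrtr_sqr (ger0_norm (Re_norm_ge0 a)) (norm_Re a).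
by rewrite (rmorphM (real_complex R)).
Qed.
Lemma rkhs_norm0_eq0 f : rkhs_norm f = 0 -> f = 0.
Proof.
move=> /complexI/eqP; rewrite sqrtr_eq0 => f0; apply/val_inj => /=.
apply: (dual_norm2_eq0 (rkhsP f)); apply/eqP; rewrite eq_le f0 dual_norm2_ge0//; exact: rkhsP.
Qed.

HB.instance Definition _ := Lmodule_isNormed.Build C rkhs
  rkhs_ler_normD rkhs_normrZ rkhs_norm0_eq0.

Lemma rkhs_normE (f : rkhs) : `|f| = (Num.sqrt (dual_norm2 k f))%:C.
Proof. by []. Qed.

Lemma rkhs_ev_le (f : rkhs) l :
  `|complex.Re (ev f l)| <= Num.sqrt (dual_norm2 k f) * Num.sqrt (energy k l).
Proof.
rewrite ler_norml ev_le ?andbT; last exact: rkhsP.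
rewrite lerNl -ReN -evN -(dual_norm2N (rkhsP f)); apply: ev_le.
exact/dual_boundedN/rkhsP.
Qed.

(** Evaluation at a combination is continuous for the norm, so a Cauchy filter
    has a pointwise limit h.  The bounds on the dual gaps of differences pass to
    this limit, which gives convergence in norm. *)
Lemma rkhs_complete (F : set_system rkhs) : ProperFilter F -> cauchy F -> cvg F.
Proof.
move=> FF /cauchyP Fc.
have near_center (e : R) : 0 < e ->
    exists g : rkhs, F [set f : rkhs | Num.sqrt (dual_norm2 k (f - g : rkhs)) < e].
  move=> e0; have [|g Fg] := Fc e%:C; first by rewrite ltcR.
  exists g; apply: filterS Fg => f /=.
  by rewrite -ball_normE /= -normrN opprB rkhs_normE ltcR.
have ev_cvg l : cvg (complex.Re (ev (f : rkhs) l) @[f --> F]).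
  apply: R_complete; apply: cauchy_exP => e e0.
  have K0 : 0 < Num.sqrt (energy k l) + 1 by rewrite ltr_wpDl// sqrtr_ge0.
  have [g Fg] := near_center _ (divr_gt0 e0 K0).
  exists (complex.Re (ev g l)); rewrite /nbhs /=; apply: filterS Fg => f /= fg.
  rewrite -ball_normE /= -normrN opprB -ReB -evB.
  apply: le_lt_trans (rkhs_ev_le (f - g) l) _.
  move: fg; rewrite ltr_pdivlMr//; apply: le_lt_trans.
  by rewrite ler_wpM2l ?sqrtr_ge0// lerDl.
pose lim_re l := lim (complex.Re (ev (f : rkhs) l) @[f --> F]).
pose h : X -> C := fun x => lim_re [:: (1, x)] +i* lim_re [:: ('i%C, x)].
have ev_h l : complex.Re (ev (f : rkhs) l) @[f --> F] --> complex.Re (ev h l).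
  have evE (g : X -> C) : complex.Re (ev g l) =
      \sum_(p <- l) (complex.Re p.1 * complex.Re (ev g [:: (1, p.2)]) +
                    complex.Im p.1 * complex.Re (ev g [:: ('i%C, p.2)])).
    rewrite /ev Re_sum; apply: eq_bigr => -[[a b] x] _; rewrite !big_seq1 /=.
    by case: (g x) => u v /=; ring.
  rewrite evE; under eq_fun do rewrite evE.
  apply: cvg_big => [|p _]; first exact: add_continuous.
  apply: cvgD; apply: cvgMl_tmp.
    by rewrite {2}/ev big_seq1 /= oppr0 mul1r mul0r subr0; exact: ev_cvg.
  rewrite {2}/ev big_seq1 /= mul0r sub0r mulN1r opprK; exact: ev_cvg.
have gap_le (e : R) (g : rkhs) : 0 < e ->
    F [set f : rkhs | Num.sqrt (dual_norm2 k (f - g : rkhs)) < e] ->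
    forall l, dual_gap k (h - g) l <= e ^+ 2.
  move=> e0 Fg l.
  have c : dual_gap k ((f : rkhs) - g : rkhs) l @[f --> F] --> dual_gap k (h - g) l.
    rewrite /dual_gap evB ReB.
    under eq_fun do rewrite evB ReB.
    apply: cvgB; last exact: cvg_cst.
    by apply: cvgMl_tmp; apply: cvgB; [exact: ev_h|exact: cvg_cst].
  apply: (cvgr_to_le c); apply: filterS Fg => f /= fg.
  apply: le_trans (gap_ub l (rkhsP (f - g))) _.
  rewrite -[leLHS]sqr_sqrtr ?dual_norm2_ge0//; last exact: (rkhsP (f - g)).
  by rewrite ler_sqr ?nnegrE ?sqrtr_ge0 ?ltW.
have bh : dual_bounded k h.
  have [g Fg] := near_center 1 ltr01.
  rewrite -(subrK (g : X -> C) h); apply: dual_boundedD (rkhsP g).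
  by apply: dual_boundedP; exact: (gap_le 1 g ltr01 Fg).
pose hh : rkhs := Rkhs (asboolT bh : h \in dual_boundedb).
apply/cvg_ex; exists hh; apply/cvg_ballP => e e0.
have eR : e = (complex.Re e)%:C by rewrite RRe_real// gtr0_real.
have e20 : 0 < complex.Re e / 2 by rewrite divr_gt0// -ltcR -eR.
have [g Fg] := near_center _ e20.
near=> f; rewrite -ball_normE /= eR rkhs_normE ltcR.
have -> : (hh - f : rkhs) = (hh - g) + (g - f) by rewrite addrA subrK.
apply: le_lt_trans (dual_norm_leD (rkhsP _) (rkhsP _)) _.
rewrite [ltRHS]splitr ler_ltD//.
  have := dual_norm2_le (gap_le _ _ e20 Fg).
  rewrite -(ler_sqrt _ (sqr_ge0 _)) sqrtr_sqr (ger0_norm (ltW e20)); exact.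
have -> : dual_norm2 k (g - f : rkhs) = dual_norm2 k (f - g : rkhs).
  rewrite -(dual_norm2N (rkhsP (f - g))); congr dual_norm2.
  by rewrite -[LHS]/((g : X -> C) - f) -[RHS]/(- ((f : X -> C) - g)) opprB.
by near: f.
Unshelve. all: by end_near. Qed.

HB.instance Definition _ := Uniform_isComplete.Build rkhs rkhs_complete.

(** Sesquilinearity forces the imaginary part: Im <f, g> = Re <f, i g>. *)
Definition rkhs_dot (f g : rkhs) : C :=
  rdot k f g +i* rdot k f ('i%C *: (g : X -> C)).

Lemma rdotNl (f g : X -> C) : dual_bounded k f -> dual_bounded k g ->
  rdot k (- f) g = - rdot k f g.
Proof.
move=> bf bg; rewrite (rdotC (dual_boundedN bf) bg) rdotNr//.
by rewrite (rdotC bg bf).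
Qed.

Lemma rdotil (f g : X -> C) : dual_bounded k f -> dual_bounded k g ->
  rdot k ('i%C *: f) g = - rdot k f ('i%C *: g).
Proof.
move=> bf bg; have bif := dual_boundedZ 'i%C bf; have big := dual_boundedZ 'i%C bg.
rewrite -[LHS]rdotii// scalerA -expr2 sqr_i scaleN1r rdotNl//.
Qed.

Lemma rkhs_dot_herm (f g : rkhs) :
  rkhs_dot f g = (-1) ^+ false * Num.conj (rkhs_dot g f).
Proof.
rewrite mul1r /rkhs_dot; have [bf bg] := (rkhsP f, rkhsP g).
apply: complex_eqP => /=; first exact: rdotC.
by rewrite -rdotil// rdotC//; exact: dual_boundedZ.
Qed.

Lemma rkhs_dot_linear (h : rkhs) : scalar (fun f => rkhs_dot f h).
Proof.
move=> a f g; have [bf bg bh] := And3 (rkhsP f) (rkhsP g) (rkhsP h).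
have [bif bih] := (dual_boundedZ 'i%C bf, dual_boundedZ 'i%C bh).
have af : a *: (f : X -> C) =
    (complex.Re a)%:C *: (f : X -> C) + (complex.Im a)%:C *: ('i%C *: (f : X -> C)).
  by rewrite scalerA -scalerDl [in LHS](complexE a) mulrC.
have E u : dual_bounded k u -> rdot k (a *: f + g : rkhs) u =
    complex.Re a * rdot k f u + complex.Im a * rdot k ('i%C *: (f : X -> C)) u
    + rdot k g u.
  move=> bu; have b1 := dual_boundedZ (complex.Re a)%:C bf.
  have b2 := dual_boundedZ (complex.Im a)%:C bif.
  have b12 := dual_boundedD b1 b2.
  have -> : rkhs_fun (a *: f + g) = (complex.Re a)%:C *: (f : X -> C) +
      (complex.Im a)%:C *: ('i%C *: (f : X -> C)) + g by rewrite -af.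
  rewrite rdotC//; last exact: dual_boundedD.
  by rewrite !rdotDr// !rdotZr// (rdotC bf)// (rdotC bif)// (rdotC bg).
rewrite /rkhs_dot !E// !rdotil//.
rewrite scalerA -expr2 sqr_i scaleN1r rdotNr//.
by case: a {af E} => x y; apply: complex_eqP => /=; ring.
Qed.

Lemma rkhs_dot_self f : rkhs_dot f f = `|f| ^+ 2.
Proof.
have bf := rkhsP f; rewrite rkhs_normE -(rmorphXn (real_complex R)) /=.
rewrite sqr_sqrtr ?dual_norm2_ge0// /rkhs_dot rdot_self//; congr (_ +i* _).
have := rdotil bf bf; rewrite rdotC//; last exact: dual_boundedZ.
by move=> E; apply/eqP; rewrite -[_ == 0](mulrn_eq0 _ 2) mulr2n {1}E addNr.
Qed.

Lemma rkhs_dot_bilinear :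
  bilinear_for *%R (Num.conj \; *%R) rkhs_dot.
Proof.
split=> h; first exact: rkhs_dot_linear.
move=> a f g; rewrite rkhs_dot_herm mul1r rkhs_dot_linear rmorphD rmorphM /=.
by rewrite (rkhs_dot_herm h f) (rkhs_dot_herm h g) !mul1r.
Qed.

HB.instance Definition _ := @bilinear_isBilinear.Build C rkhs rkhs C
  *%R (Num.conj \; *%R) rkhs_dot rkhs_dot_bilinear.
HB.instance Definition _ := @isHermitianSesquilinear.Build C rkhs false Num.conj
  rkhs_dot rkhs_dot_herm.
Lemma rkhs_dot_gt0 (f : rkhs) : f != 0 -> 0 < rkhs_dot f f.
Proof. by move=> f0; rewrite rkhs_dot_self exprn_gt0// normr_gt0. Qed.
HB.instance Definition _ := @isDotProduct.Build C rkhs rkhs_dot rkhs_dot_gt0.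

HB.instance Definition _ := @NormedModule_isHilbert.Build R rkhs rkhs_dot rkhs_dot_self.

End Rkhs.

Section RkhsMaps.
Context {R : realType} {X : Type} (k : psd_kernel (R := R) (X := X)).
Local Notation rkhs := (rkhs k).

Lemma synth_rkhsP l : synth k l \in dual_boundedb k.
Proof. exact/asboolP/dual_bounded_synth. Qed.
Definition synth_rkhs l : rkhs := Rkhs (synth_rkhsP l).

Definition kernel_at (y : X) : rkhs := synth_rkhs [:: (1, y)].

Lemma kernel_atE x y : kernel_at y x = k x y.
Proof. by rewrite /= /synth big_seq1 mul1r. Qed.

Lemma rnorm_rkhs (f : rkhs) : rnorm f = Num.sqrt (dual_norm2 k f).
Proof. by []. Qed.

Lemma hdot_rkhs (f g : rkhs) : hdot f g = rkhs_dot f g.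
Proof. by []. Qed.

Lemma reproducing (f : rkhs) y : hdot f (kernel_at y) = f y.
Proof.
have bf := rkhsP f; have bk := rkhsP (kernel_at y).
have e1 : ev f [:: (1, y)] = f y by rewrite /ev big_seq1 rmorph1 mul1r.
rewrite hdot_rkhs /rkhs_dot; apply: complex_eqP => /=.
  by rewrite rdotC// rdot_synth// e1.
rewrite -[LHS]opprK -rdotil//.
rewrite rdotC//; last exact: dual_boundedZ.
rewrite rdot_synth; last exact: dual_boundedZ.
by rewrite evZ e1 ReiM opprK.
Qed.

Lemma synth_rkhsE l : synth_rkhs l = \sum_(p <- l) p.1 *: kernel_at p.2.
Proof.
apply: val_inj; rewrite /= -[RHS]/(rkhs_fun (\sum_(p <- l) p.1 *: kernel_at p.2)).
rewrite (big_morph (@rkhs_fun R X k) (id1 := 0) (op1 := +%R))//.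
apply/funext => x; rewrite fct_sumE /synth; apply: eq_bigr => p _.
by rewrite -[in LHS]kernel_atE.
Qed.

Lemma rkhs_span_dense (f : rkhs) (e : R) : 0 < e -> exists l, rnorm (f - synth_rkhs l) < e.
Proof. by move=> e0; have [l hl] := synth_dense (rkhsP f) e0; exists l. Qed.

Section Pullback.
Variables (s t : X -> X).
Hypotheses (st : cancel s t) (ts : cancel t s) (ks : forall x y, k (s x) (s y) = k x y).

Definition map_combo (u : X -> X) (l : combo (R := R) (X := X)) := [seq (p.1, u p.2) | p <- l].

(** Composition with t moves the points of a combination by t, and this does not
    change its energy because t preserves the kernel. *)
Lemma gap_pullback (f : X -> R[i]) l : dual_gap k (f \o t) l = dual_gap k f (map_combo t l).
Proof.
rewrite /dual_gap /energy /ev !big_map /=; congr (_ - complex.Re _).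
apply: eq_bigr => p _; rewrite /synth big_map; congr (_ * _).
by apply: eq_bigr => q _ /=; rewrite -[in RHS]ks !ts.
Qed.

Lemma pullback_boundedP (f : rkhs) : (f \o t) \in dual_boundedb k.
Proof.
apply/asboolP; apply: (@dual_boundedP _ _ _ _ (dual_norm2 k f)) => l.
by rewrite gap_pullback gap_ub//; exact: rkhsP.
Qed.

Definition pullback (f : rkhs) : rkhs := Rkhs (pullback_boundedP f).

Lemma pullback_linear : linear pullback.
Proof. by move=> a f g; exact: val_inj. Qed.

Lemma dual_norm2_pullback (f : rkhs) : dual_norm2 k (f \o t) = dual_norm2 k f.
Proof.
apply/eqP; rewrite eq_le; apply/andP; split; apply: dual_norm2_le => l.
  by rewrite gap_pullback gap_ub//; exact: rkhsP.
have -> : dual_gap k f l = dual_gap k (f \o t) (map_combo s l).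
  rewrite gap_pullback /map_combo -map_comp; congr dual_gap.
  by rewrite -[LHS]map_id; apply: eq_map => -[c x] /=; rewrite st.
by apply: gap_ub; exact: (rkhsP (pullback f)).
Qed.

Lemma rnorm_pullback (f : rkhs) : rnorm (pullback f) = rnorm f.
Proof. by rewrite !rnorm_rkhs /= dual_norm2_pullback. Qed.

Lemma hdot_pullback (f g : rkhs) : hdot (pullback f) (pullback g) = hdot f g.
Proof.
have rd (u v : rkhs) : rdot k (u \o t) (v \o t) = rdot k u v.
  rewrite /rdot; congr ((_ - _) / _).
    exact: (dual_norm2_pullback (u + v)).
  exact: (dual_norm2_pullback (u - v)).
rewrite !hdot_rkhs /rkhs_dot rd; congr (_ +i* _).
exact: (rd f ('i%C *: g)).
Qed.

Lemma pullback_bounded : bounded_op pullback.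
Proof.
by split; [exact: pullback_linear|exists 1 => f; rewrite rnorm_pullback mul1r].
Qed.

End Pullback.
End RkhsMaps.

(** * Inner products, the Riesz representation and adjoints *)

Section HilbertBasics.
Context {R : realType} {H : hilbertType R}.
Implicit Types x y z : H.
Local Notation dot := (@hdot R H).

Lemma hdotC x y : dot y x = Num.conj (dot x y).
Proof. by rewrite (hermC dot) mul1r. Qed.
Lemma hdotDl x y z : dot (x + y) z = dot x z + dot y z.
Proof. exact: (linearDl dot). Qed.
Lemma hdotZl a x z : dot (a *: x) z = a * dot x z.
Proof. exact: (linearZl_LR dot). Qed.
Lemma hdotDr x y z : dot z (x + y) = dot z x + dot z y.
Proof. exact: (linearDr dot). Qed.
Lemma hdotZr a x z : dot z (a *: x) = Num.conj a * dot z x.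
Proof. by rewrite (hdotC (a *: x)) hdotZl rmorphM /= -(hdotC x z). Qed.
Lemma hdotNl x z : dot (- x) z = - dot x z.
Proof. by rewrite -scaleN1r hdotZl mulN1r. Qed.
Lemma hdotNr x z : dot z (- x) = - dot z x.
Proof. by rewrite -scaleN1r hdotZr rmorphN1 mulN1r. Qed.
Lemma hdotBl x y z : dot (x - y) z = dot x z - dot y z.
Proof. by rewrite hdotDl hdotNl. Qed.
Lemma hdotBr x y z : dot z (x - y) = dot z x - dot z y.
Proof. by rewrite hdotDr hdotNr. Qed.
Lemma hdot0l z : dot 0 z = 0.
Proof. by rewrite -(scale0r 0) hdotZl mul0r. Qed.
Lemma hdot0r z : dot z 0 = 0.
Proof. by rewrite hdotC hdot0l rmorph0. Qed.
Lemma hdot_suml (I : Type) (r : seq I) (P : pred I) (F : I -> H) z :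
  dot (\sum_(i <- r | P i) F i) z = \sum_(i <- r | P i) dot (F i) z.
Proof. by apply: (big_morph (dot^~ z)) => [x y|]; [exact: hdotDl|exact: hdot0l]. Qed.
Lemma hdot_sumr (I : Type) (r : seq I) (P : pred I) (F : I -> H) z :
  dot z (\sum_(i <- r | P i) F i) = \sum_(i <- r | P i) dot z (F i).
Proof. by apply: (big_morph (dot z)) => [x y|]; [exact: hdotDr|exact: hdot0r]. Qed.

Lemma rnorm_ge0 x : 0 <= rnorm x.
Proof. by rewrite /rnorm -ler0c RRe_real ?normr_real. Qed.
Lemma hilbert_normE x : `|x| = (rnorm x)%:C.
Proof. by rewrite RRe_real ?normr_real. Qed.
Lemma hdot_self x : dot x x = ((rnorm x) ^+ 2)%:C.
Proof. by rewrite hdotE hilbert_normE rmorphXn. Qed.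
Lemma Re_hdot_self x : complex.Re (dot x x) = rnorm x ^+ 2.
Proof. by rewrite hdot_self. Qed.
Lemma rnormZ a x : rnorm (a *: x) = complex.Re `|a| * rnorm x.
Proof. by rewrite /rnorm normrZ norm_Re ReZ. Qed.
Lemma rnormN x : rnorm (- x) = rnorm x.
Proof. by rewrite /rnorm normrN. Qed.
Lemma rnorm_leD x y : rnorm (x + y) <= rnorm x + rnorm y.
Proof. by rewrite -lecR rmorphD /= -!hilbert_normE ler_normD. Qed.
Lemma rnorm0 : rnorm (0 : H) = 0.
Proof. by rewrite /rnorm normr0. Qed.

Lemma Re_hdot_le x y : complex.Re (dot x y) <= rnorm x * rnorm y.
Proof.
have := @sqr_bound _ (complex.Re (dot x y)) (rnorm y ^+ 2) (rnorm x ^+ 2).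
rewrite !sqrtr_sqr !ger0_norm ?rnorm_ge0//; apply; rewrite ?sqr_ge0// => t.
have := sqr_ge0 (rnorm (x - t%:C *: y)).
rewrite -!Re_hdot_self hdotBl !hdotBr !hdotZl !hdotZr (hdotC x y).
have -> : Num.conj t%:C = t%:C by apply/conj_Creal/complex_realP; exists t.
rewrite !ReB !ReZ ReJ; lra.
Qed.

Lemma norm_hdot_le x y : complex.Re `|dot x y| <= rnorm x * rnorm y.
Proof.
have [u u1 uz] := unimodular_conj_mul (dot x y).
have := Re_hdot_le x (u *: y).
by rewrite hdotZr uz rnormZ u1 mul1r.
Qed.

Lemma hdot_inj x y : (forall z, dot z x = dot z y) -> x = y.
Proof.
move=> h; apply/eqP; rewrite -subr_eq0 -normr_eq0 hilbert_normE; apply/eqP.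
have := hdot_self (x - y); rewrite hdotBr h subrr => /complexI/esym/eqP.
by rewrite sqrf_eq0 => /eqP ->.
Qed.

Lemma rnormB_sqr x y :
  rnorm (x - y) ^+ 2 = rnorm x ^+ 2 + rnorm y ^+ 2 - 2 * complex.Re (dot x y).
Proof.
by rewrite -!Re_hdot_self hdotBl !hdotBr (hdotC x y) !ReB ReJ; ring.
Qed.

Lemma gram_psd (l : combo (R := R) (X := H)) : 0 <= complex.Re
    (\sum_(p <- l) \sum_(q <- l) Num.conj p.1 * (q.1 * dot q.2 p.2)).
Proof.
suff -> : \sum_(p <- l) \sum_(q <- l) Num.conj p.1 * (q.1 * dot q.2 p.2) =
    dot (\sum_(q <- l) q.1 *: q.2) (\sum_(p <- l) p.1 *: p.2).
  by rewrite Re_hdot_self sqr_ge0.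
rewrite hdot_sumr; apply: eq_bigr => p _; rewrite hdotZr hdot_suml mulr_sumr.
by apply: eq_bigr => q _; rewrite hdotZl.
Qed.

(** The elements of the Hilbert space of this kernel are the bounded
    conjugate-linear functionals on H. *)
Definition gram : psd_kernel (R := R) (X := H) :=
  PsdKernel (fun x y => hdotC y x) gram_psd.

Lemma gram_synth l : synth gram l = dot (\sum_(p <- l) p.1 *: p.2).
Proof.
apply/funext => x; rewrite hdot_suml; apply: eq_bigr => p _.
by rewrite hdotZl.
Qed.

Lemma gram_norm2 x : dual_norm2 gram (dot x) = rnorm x ^+ 2.
Proof.
have <- : synth gram [:: (1, x)] = dot x by rewrite gram_synth big_seq1 scale1r.
by rewrite dual_norm2_synth /energy gram_synth /ev !big_seq1 rmorph1 mul1r scale1r Re_hdot_self.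
Qed.

Lemma gram_bounded x : dual_bounded gram (dot x).
Proof.
have <- : synth gram [:: (1, x)] = dot x by rewrite gram_synth big_seq1 scale1r.
exact: dual_bounded_synth.
Qed.

(** The conjugate of phi lies in the Hilbert space of the Gram kernel, where the
    functions <v, .> approximate it.  As v |-> <v, .> is isometric, the
    approximating vectors form a Cauchy filter on H, and the limit represents
    phi. *)
Lemma riesz (phi : H -> R[i]) (M : R) : scalar phi ->
  (forall x, complex.Re `|phi x| <= M * rnorm x) ->
  exists z, forall x, phi x = dot x z.
Proof.
move=> phil phib; pose f x := Num.conj (phi x).
have phiE (l : combo) : ev f l = Num.conj (phi (\sum_(p <- l) p.1 *: p.2)).
  have phiD x y : phi (x + y) = phi x + phi y.
    by have := phil 1 x y; rewrite scale1r mul1r.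
  have phi0 : phi 0 = 0.
    by have := phiD 0 0; rewrite addr0 => /eqP; rewrite -subr_eq subrr eq_sym => /eqP.
  have phiZ := scalable_linear phil.
  rewrite (big_morph phi phiD phi0) rmorph_sum; apply: eq_bigr => p _ /=.
  by rewrite phiZ rmorphM.
have bf : dual_bounded gram f.
  apply: (@dual_boundedP _ _ _ _ (M ^+ 2)) => l; rewrite /dual_gap phiE ReJ.
  rewrite -dual_norm2_synth gram_synth gram_norm2; set v := \sum_(p <- l) _.
  have h1 := le_trans (Re_le_norm (phi v)) (phib v).
  have := sqr_ge0 (M - rnorm v); lra.
pose B (e : R) : set H := [set v | Num.sqrt (dual_norm2 gram (f - dot v)) < e].
pose F := filter_from [set e : R | 0 < e] B.
have FF : ProperFilter F.
  apply: filter_from_proper; last first.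
    move=> e e0; have [l] := synth_dense bf e0.
    by rewrite gram_synth => hl; exists (\sum_(p <- l) p.1 *: p.2).
  apply: filter_from_filter; first by exists 1 => /=.
  move=> d e d0 e0; exists (Num.min d e); first by rewrite /= lt_min d0.
  by move=> v; rewrite /B /= lt_min => /andP[].
have bfv v : dual_bounded gram (f - dot v).
  by apply: dual_boundedB bf _; exact: gram_bounded.
have Fc : cauchy F.
  apply: cauchy_exP => e e0.
  have eR : e = (complex.Re e)%:C by rewrite RRe_real// gtr0_real.
  have e20 : 0 < complex.Re e / 2 by rewrite divr_gt0// -ltcR -eR.
  have FB : F (B (complex.Re e / 2)) by exists (complex.Re e / 2).
  have [v hv] := filter_ex FB.
  exists v, (complex.Re e / 2) => // w hw.
  rewrite -ball_normE /= eR hilbert_normE ltcR.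
  rewrite -[ltLHS]ger0_norm ?rnorm_ge0// -sqrtr_sqr -gram_norm2.
  have -> : dot (v - w) = (f - dot w) + - (f - dot v).
    by apply/funext => x; rewrite !fctE hdotBl; ring.
  apply: le_lt_trans (dual_norm_leD (bfv w) (dual_boundedN (bfv v))) _.
  by rewrite dual_norm2N// [ltRHS]splitr ltrD.
have cF : cvg F by apply: cauchy_cvg Fc.
pose z := lim F; have zF : F --> z := cF.
exists z => x; suff : f x = dot z x by rewrite (hdotC z x) => <-; rewrite conjCK.
apply/eqP; rewrite -subr_eq0 -normr_eq0 norm_Re.
suff -> : complex.Re `|f x - dot z x| = 0 by [].
apply/eqP; rewrite eq_le Re_norm_ge0 andbT.
apply/ler_addgt0Pl => e e0; rewrite addr0.
have K0 : 0 < rnorm x + 1 by rewrite ltr_wpDl// rnorm_ge0.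
have d0 : 0 < e / 2 / (rnorm x + 1) by rewrite !divr_gt0.
have h1 : F (B (e / 2 / (rnorm x + 1))) by exists (e / 2 / (rnorm x + 1)).
have h2 : F [set v | rnorm (z - v) < e / 2 / (rnorm x + 1)].
  apply: zF; apply/nbhs_ballP; exists (e / 2 / (rnorm x + 1))%:C => /=.
    by rewrite ltcR.
  by move=> v; rewrite -ball_normE /= hilbert_normE ltcR.
have [v [hv1 hv2]] := filter_ex (filterI h1 h2).
have -> : f x - dot z x = (f x - dot v x) - dot (z - v) x.
  by rewrite hdotBl; ring.
rewrite -lecR -norm_Re; apply: le_trans (ler_normB _ _) _.
rewrite (norm_Re (f x - _)) (norm_Re (dot _ x)) -rmorphD lecR (splitr e).
apply: lerD.
  have := ev_norm_le [:: (1, x)] (bfv v).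
  rewrite -dual_norm2_synth gram_synth /ev !big_seq1 rmorph1 mul1r scale1r gram_norm2.
  rewrite sqrtr_sqr (ger0_norm (rnorm_ge0 _)) => /le_trans; apply.
  apply: le_trans (_ : e / 2 / (rnorm x + 1) * (rnorm x + 1) <= _); last by rewrite divfK ?gt_eqF.
  by rewrite ler_pM ?sqrtr_ge0 ?rnorm_ge0 ?lerDl// ltW.
apply: le_trans (norm_hdot_le _ _) _.
apply: le_trans (_ : e / 2 / (rnorm x + 1) * (rnorm x + 1) <= _); last by rewrite divfK ?gt_eqF.
by rewrite ler_pM ?rnorm_ge0 ?lerDl// ltW.
Qed.
End HilbertBasics.

Section Adjoint.
Context {R : realType} {H H' : hilbertType R}.

(** Riesz representation makes the set from which the adjoint is chosen
    nonempty. *)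
Lemma adjointP (A : H -> H') : bounded_op A ->
  forall x y, hdot (A x) y = hdot x (adjoint A y).
Proof.
move=> [Al [M AM]] x y.
have [z hz] : exists z, forall x, hdot (A x) y = hdot x z.
  apply: (@riesz _ _ _ (M * rnorm y)) => [a u v|u].
    by rewrite Al hdotDl hdotZl.
  apply: le_trans (norm_hdot_le _ _) _; rewrite mulrAC.
  by apply: ler_wpM2r; [exact: rnorm_ge0|exact: AM].
by move: x; apply: (@xgetPex _ 0 [set z | forall x, hdot (A x) y = hdot x z]); exists z.
Qed.

Lemma adjoint_unique (A : H -> H') (B : H' -> H) :
  (forall x y, hdot (A x) y = hdot x (B y)) -> adjoint A = B.
Proof.
move=> AB; apply/funext => y; apply: hdot_inj => x; rewrite -AB.
by rewrite -(@xgetPex _ 0 [set z | forall x, hdot (A x) y = hdot x z])//; exists (B y) => z.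
Qed.

Lemma bounded_op_ge0 (A : H -> H') : bounded_op A ->
  exists2 M : R, 0 <= M & forall x, rnorm (A x) <= M * rnorm x.
Proof.
move=> [_ [M AM]]; exists `|M| => // x; apply: le_trans (AM x) _.
by rewrite ler_wpM2r ?rnorm_ge0// ler_norm.
Qed.

Lemma adjoint_bounded (A : H -> H') : bounded_op A -> bounded_op (adjoint A).
Proof.
move=> bA; split.
  move=> a x y; apply: hdot_inj => z.
  by rewrite -adjointP// !hdotDr !hdotZr !adjointP.
have [M M0 AM] := bounded_op_ge0 bA; exists M => y.
have [->|y0] := eqVneq (adjoint A y) 0; first by rewrite rnorm0 mulr_ge0 ?rnorm_ge0.
have y1 : 0 < rnorm (adjoint A y) by rewrite -ltcR -hilbert_normE normr_gt0.
rewrite -(ler_pM2l y1) -expr2 -Re_hdot_self -adjointP//.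
apply: le_trans (Re_hdot_le _ _) _.
by rewrite mulrCA mulrA ler_wpM2r ?rnorm_ge0.
Qed.

End Adjoint.

Section BoundedOps.
Context {R : realType} {H H' : hilbertType R}.

(** Boundedness is essential here: the supremum of an unbounded set is 0. *)
Lemma rnorm_le_opnorm (A : H -> H') (x : H) :
  bounded_op A -> rnorm (A x) <= opnorm A * rnorm x.
Proof.
move=> bA; have [M M0 AM] := bounded_op_ge0 bA; have [Al _] := bA.
have AZ := scalable_linear Al.
have ub : has_ubound [set rnorm (A x) | x in [set x : H | rnorm x <= 1]].
  exists M => _ [u /= u1 <-]; apply: le_trans (AM u) _.
  by rewrite -[leRHS]mulr1 ler_wpM2l.
have [->|x0] := eqVneq x 0.
  by rewrite rnorm0 mulr0 -(scale0r 0) AZ /= scale0r rnorm0.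
have nx : 0 < rnorm x by rewrite -ltcR -hilbert_normE normr_gt0.
rewrite -ler_pdivrMr//; apply: ub_le_sup => //; exists ((rnorm x)^-1%:C *: x) => /=.
  rewrite rnormZ normc_def /= expr0n addr0 sqrtr_sqr ger0_norm ?invr_ge0 ?rnorm_ge0//.
  by rewrite mulVf// gt_eqF.
rewrite AZ /= rnormZ normc_def /= expr0n addr0 sqrtr_sqr ger0_norm ?invr_ge0 ?rnorm_ge0//.
by rewrite mulrC.
Qed.

Lemma opnorm_le (A : H -> H') (M : R) :
  (forall x, rnorm x <= 1 -> rnorm (A x) <= M) -> opnorm A <= M.
Proof.
move=> h; apply: ge_sup => [|_ [x /= x1 <-]]; last exact: h.
by exists (rnorm (A 0)), 0 => //=; rewrite rnorm0.
Qed.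

Lemma bounded_op_sum (I : Type) (s : seq I) (c : I -> R[i]) (A : I -> H -> H') :
  (forall i, bounded_op (A i)) -> bounded_op (fun x => \sum_(i <- s) c i *: A i x).
Proof.
move=> bA; split.
  move=> a x y; rewrite scaler_sumr -big_split; apply: eq_bigr => i _ /=.
  by have [-> _] := bA i; rewrite scalerDr !scalerA mulrC.
elim: s => [|i s [M IH]]; first by exists 0 => x; rewrite big_nil rnorm0 mul0r.
have [_ [Mi AM]] := bA i; exists (complex.Re `|c i| * Mi + M) => x.
rewrite big_cons mulrDl; apply: le_trans (rnorm_leD _ _) _.
by rewrite lerD// rnormZ -mulrA ler_wpM2l ?Re_norm_ge0.
Qed.

End BoundedOps.

Lemma bounded_op_comp (R : realType) (H1 H2 H3 : hilbertType R)
    (A : H2 -> H3) (B : H1 -> H2) : bounded_op A -> bounded_op B -> bounded_op (A \o B).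
Proof.
move=> bA bB; have [M M0 AM] := bounded_op_ge0 bA; have [Bl [N BN]] := bB.
split; first by have [Al _] := bA; move=> a x y /=; rewrite Bl Al.
by exists (M * N) => x /=; apply: le_trans (AM _) _; rewrite -mulrA ler_wpM2l.
Qed.

(** * Limits in Hilbert spaces and in real row vectors *)

Section Limits.
Context {R : realType}.

Lemma squeeze0 (T : Type) (F : set_system T) (FF : Filter F) (f e : T -> R) :
  (\forall a \near F, `|f a| <= e a) -> e a @[a --> F] --> 0 -> f a @[a --> F] --> 0.
Proof.
move=> fe e0; apply: (@squeeze_cvgr _ _ _ _ (fun a => - e a) e) => //.
  by apply: filterS fe => a; rewrite ler_norml.
by rewrite -oppr0; exact: cvgN.
Qed.

Context {H : hilbertType R}.

Lemma cvg_rnorm (T : Type) (F : set_system T) (FF : Filter F) (f : T -> H) (x : H) :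
  f a @[a --> F] --> x <-> rnorm (f a - x) @[a --> F] --> 0.
Proof.
split => [/cvgrPdist_lt fx|/cvgrPdist_lt fx].
  apply/cvgrPdist_lt => e e0.
  have e0' : 0 < e%:C by rewrite ltcR.
  apply: filterS (fx _ e0') => a; rewrite hilbert_normE ltcR sub0r normrN.
  by rewrite -opprB rnormN ger0_norm ?rnorm_ge0.
apply/cvgrPdist_lt => e e0.
have eR : e = (complex.Re e)%:C by rewrite RRe_real// gtr0_real.
have e0' : 0 < complex.Re e by rewrite -ltcR -eR.
apply: filterS (fx _ e0') => a; rewrite sub0r normrN.
by rewrite (ger0_norm (rnorm_ge0 _)) -rnormN opprB {2}eR hilbert_normE ltcR.
Qed.

Lemma cvg_Re_hdot (T : Type) (F : set_system T) (FF : Filter F) (f g : T -> H) (x y : H) :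
  f a @[a --> F] --> x -> g a @[a --> F] --> y ->
  complex.Re (hdot (f a) (g a)) @[a --> F] --> complex.Re (hdot x y).
Proof.
move=> /cvg_rnorm fx /cvg_rnorm gy.
have E a : complex.Re (hdot (f a) (g a)) = complex.Re (hdot (f a - x) (g a - y)) +
    complex.Re (hdot (f a - x) y) + complex.Re (hdot x (g a - y)) + complex.Re (hdot x y).
  by rewrite !(hdotBl, hdotBr) !ReB; ring.
have ReN_le (u v : H) : `|complex.Re (hdot u v)| <= rnorm u * rnorm v.
  by rewrite ler_norml Re_hdot_le lerNl -ReN -hdotNl -(rnormN u) Re_hdot_le.
suff L : complex.Re (hdot (f a - x) (g a - y)) + complex.Re (hdot (f a - x) y) +
    complex.Re (hdot x (g a - y)) + complex.Re (hdot x y) @[a --> F] -->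
    0 + 0 + 0 + complex.Re (hdot x y).
  by rewrite !add0r in L; under eq_fun do rewrite E.
apply: cvgD; last exact: cvg_cst.
apply: cvgD; first apply: cvgD.
- apply: (@squeeze0 _ _ _ _ (fun a => rnorm (f a - x) * rnorm (g a - y))).
    by near=> a.
  by rewrite -[X in _ --> X](mulr0 0); exact: cvgM.
- apply: (@squeeze0 _ _ _ _ (fun a => rnorm (f a - x) * rnorm y)).
    by near=> a.
  by rewrite -[X in _ --> X](mul0r (rnorm y)); exact: cvgMr_tmp.
- apply: (@squeeze0 _ _ _ _ (fun a => rnorm x * rnorm (g a - y))).
  by near=> a.
by rewrite -[X in _ --> X](mulr0 (rnorm x)); exact: cvgMl_tmp.
Unshelve. all: by end_near. Qed.

Lemma cvg_rV (d : nat) (U : Type) (G : set_system U) (FG : Filter G)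
    (f : U -> 'rV[R]_d) (v : 'rV[R]_d) :
  (forall i, f a 0 i @[a --> G] --> v 0 i) -> f a @[a --> G] --> v.
Proof.
move=> fv B [P Pv PB].
have h : \forall a \near G, forall i, P 0 i (f a 0 i).
  by apply: filter_forall => i; apply: (fv i); exact: Pv.
apply: filterS h => a Pa; apply: PB => i j; rewrite (ord1 i); exact: Pa.
Qed.

End Limits.

(** * Fejer sums and positivity on the torus *)

Lemma prim_root_closed (F : numClosedFieldType) (K : nat) : (0 < K)%N ->
  exists z : F, K.-primitive_root z.
Proof.
move=> K0; have [r Er] := closed_field_poly_normal ('X^K - 1 : {poly F}).
rewrite (monicP (monicXnsubC _ K0)) scale1r in Er.
suff /hasP[z _ zK] : has K.-primitive_root r by exists z.
apply: has_prim_root => //.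
- by apply/allP => z; rewrite -root_prod_XsubC -Er.
- by rewrite -separable_prod_XsubC -Er separable_Xn_sub_1// pnatr_eq0 -lt0n.
- by rewrite -ltnS -(size_prod_XsubC r id) -Er size_XnsubC.
Qed.

Section Characters.
Context {R : realType} {d : nat}.
Implicit Types (l : 'rV[R[i]]_d) (n m : 'rV[int]_d).

(** The character of Z^d attached to a point of the torus. *)
Definition chi l n : R[i] := \prod_i (l 0 i) ^ (n 0 i).

Lemma torus_neq0 l i : torus l -> l 0 i != 0.
Proof. by move=> /(_ i) li; rewrite -normr_eq0 li oner_eq0. Qed.

Lemma chi0 l : chi l 0 = 1.
Proof. by apply: big1 => i _; rewrite mxE expr0z. Qed.
Lemma chiD l n m : torus l -> chi l (n + m) = chi l n * chi l m.
Proof.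
move=> lT; rewrite /chi -big_split; apply: eq_bigr => i _ /=.
by rewrite mxE expfzDr// torus_neq0.
Qed.
Lemma chiN l n : torus l -> chi l (- n) = Num.conj (chi l n).
Proof.
move=> lT; rewrite /chi rmorph_prod; apply: eq_bigr => i _ /=.
have -> : (- n) 0 i = - n 0 i by rewrite mxE.
have li : (l 0 i)^-1 = Num.conj (l 0 i).
  by rewrite invC_norm lT expr1n invr1 mul1r.
by rewrite -exprz_inv li fmorphXz.
Qed.
Lemma chiB l n m : torus l -> chi l (n - m) = chi l n * Num.conj (chi l m).
Proof. by move=> lT; rewrite chiD// chiN. Qed.
Lemma normXz (z : R[i]) (n : int) : `|z ^ n| = `|z| ^ n.
Proof. by case: n => n; rewrite ?NegzE -?exprz_inv -?exprnP normrX ?normfV. Qed.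
Lemma chi_norm l n : torus l -> `|chi l n| = 1.
Proof.
move=> lT; rewrite /chi normr_prod big1// => i _.
by rewrite normXz lT exp1rz.
Qed.

Definition box (N : nat) := {ffun 'I_d -> 'I_N}.
Definition box_pt N (m : box N) : 'rV[int]_d := \row_i (m i)%:Z.

(** N^d times the Fejer mean at l of the Fourier series sum_n a(n) l^(-n). *)
Definition fejer_sum l N (a : 'rV[int]_d -> R[i]) : R[i] :=
  \sum_(m : box N) \sum_(m' : box N)
    chi l (box_pt m' - box_pt m) * a (box_pt m - box_pt m').

Lemma sum_expz_root (K : nat) (w : R[i]) (z : int) : K.-primitive_root w ->
  (`|z| < K)%N -> \sum_(j < K) (w ^+ j) ^ z = (if z == 0 then K%:R else 0).
Proof.
move=> wK zK; have w0 : w != 0.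
  apply/eqP => w0; have := prim_expr_order wK.
  by rewrite w0 expr0n; case: K wK zK {w0} => // K _ _ /eqP; rewrite eq_sym oner_eq0.
have -> : \sum_(j < K) (w ^+ j) ^ z = \sum_(j < K) (w ^ z) ^+ j.
  by apply: eq_bigr => j _; rewrite [in LHS]exprnP [in RHS]exprnP !exprz_exp mulrC.
case: eqVneq => [->|z0].
  rewrite expr0z; under eq_bigr do rewrite expr1n.
  by rewrite sumr_const card_ord.
have wz1 : w ^ z != 1.
  have h (k : nat) : (0 < k < K)%N -> w ^+ k != 1.
    move=> /andP[k0 kK]; rewrite -(prim_order_dvd wK).
    by apply: contraL kK => /(dvdn_leq k0); rewrite -leqNgt.
  case: z zK z0 {h} (h `|z|%N) => k /= kK k0 hk.
    by apply: hk; rewrite kK andbT; case: k k0 {kK}.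
  by rewrite NegzE -exprz_inv -exprnP exprVn invr_eq1; apply: hk.
have := subrX1 (w ^ z) K.
rewrite exprnP exprz_exp mulrC -exprz_exp -exprnP prim_expr_order// exp1rz subrr.
by move/esym/eqP; rewrite mulf_eq0 subr_eq0 (negPf wz1) => /eqP.
Qed.

Definition root_pt (w : R[i]) K (c : box K) : 'rV[R[i]]_d := \row_i w ^+ c i.

Lemma root_pt_torus w K (c : box K) : K.-primitive_root w -> torus (root_pt w c).
Proof.
move=> wK i; rewrite mxE normrX.
suff -> : `|w| = 1 by rewrite expr1n.
have K0 := prim_order_gt0 wK.
apply/eqP; rewrite -(@pexpr_eq1 _ _ K)// -normrX prim_expr_order// normr1//.
Qed.

(** Orthogonality of the characters of (Z/K)^d; the bound on n excludes
    nonzero multiples of K. *)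
Lemma sum_chi_root w K n : K.-primitive_root w -> (forall i, (`|n 0%R i| < K)%N) ->
  \sum_(c : box K) chi (root_pt w c) n = (if n == 0 then (K ^ d)%:R else 0).
Proof.
move=> wK nK; rewrite /chi.
under eq_bigr do under eq_bigr do rewrite mxE.
rewrite -(bigA_distr_bigA (fun i j => (w ^+ (j : 'I_K)) ^ n 0 i)).
under eq_bigr do rewrite sum_expz_root//.
case: eqVneq => [->|n0].
  under eq_bigr do rewrite mxE eqxx.
  by rewrite prodr_const card_ord natrX.
have [i ni] : exists i, n 0 i != 0.
  apply/existsP; apply: contraR n0; rewrite negb_exists => /forallP n0.
  by apply/eqP/rowP => i; rewrite mxE; apply/eqP; have := n0 i; rewrite negbK.
by rewrite (bigD1 i)//= (negPf ni) mul0r.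
Qed.

Definition pair_count N n : nat :=
  \sum_(m : box N) \sum_(m' : box N) (box_pt m - box_pt m' == n)%R.

Lemma pair_countE N n : pair_count N n =
  (\prod_i \sum_(a < N) \sum_(b < N) (a%:Z - b%:Z == n 0 i)%R)%N.
Proof.
rewrite bigA_distr_bigA; apply: eq_bigr => m _ /=.
rewrite bigA_distr_bigA; apply: eq_bigr => m' _ /=.
case: eqVneq => [<-|ne].
  by rewrite big1// => i _; rewrite !mxE eqxx.
have [i ni] : exists i, (m i)%:Z - (m' i)%:Z != n 0 i.
  apply/existsP; apply: contraR ne; rewrite negb_exists => /forallP ne.
  by apply/eqP/rowP => i; have := ne i; rewrite negbK !mxE => /eqP.
by rewrite (bigD1 i)//= (negPf ni) mul0n.
Qed.

Lemma pair_count_le N n : (pair_count N n <= N ^ d)%N.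
Proof.
rewrite pair_countE -[X in (_ <= _ ^ X)%N]card_ord -prod_nat_const.
apply: leq_prod => i _; rewrite -[X in (_ <= X)%N]card_ord -sum1_card.
apply: leq_sum => a _; set P := fun b : 'I_N => (a%:Z - b%:Z == n 0 i)%R.
have [b Pb|P0] := pickP P; last first.
  by rewrite big1// => b _; rewrite -[X in nat_of_bool X]/(P b) P0.
rewrite (bigD1 b)//= big1 => [|c cb]; first by rewrite addn0 leq_b1.
apply/eqP; rewrite eqb0; apply: contra cb => /eqP Pc; apply/eqP/val_inj => /=.
by move/eqP: Pb => Pb; lia.
Qed.

(** Once the box of side N is enlarged by D on both sides, every point of the
    inner box is the first term of a pair with difference n. *)
Lemma pair_count_ge D N n : (forall i, (`|n 0%R i| <= D)%N) ->
  (N ^ d <= pair_count (D + (N + D)) n)%N.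
Proof.
move=> nD; rewrite pair_countE -[X in (_ ^ X <= _)%N]card_ord -prod_nat_const.
apply: leq_prod => i _; rewrite -[X in (X <= _)%N]card_ord -sum1_card.
rewrite big_split_ord/= big_split_ord /= addnCA; apply: leq_trans (leq_addr _ _).
apply: leq_sum => a _.
have b_lt : (`|(D + a)%:Z - n 0%R i| < D + (N + D))%N.
  have := nD i; have := ltn_ord a; lia.
rewrite (bigD1 (Ordinal b_lt))//= (_ : _ == _); first exact: leq_addr.
have := nD i; lia.
Qed.

(** Discrete Fourier inversion: summing over the K-th roots of unity selects the
    pairs of box points whose difference is n. *)
Lemma sum_fejer_root w K N n a : K.-primitive_root w ->
  (forall i, `|n 0%R i| + N <= K)%N ->
  \sum_(c : box K) chi (root_pt w c) n * fejer_sum (root_pt w c) N a =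
  (K ^ d)%:R * ((pair_count N n)%:R * a n).
Proof.
move=> wK nK.
under eq_bigr do rewrite /fejer_sum mulr_sumr.
rewrite exchange_big /pair_count natr_sum mulr_suml mulr_sumr.
apply: eq_bigr => m _ /=.
under eq_bigr do rewrite mulr_sumr.
rewrite exchange_big natr_sum mulr_suml mulr_sumr; apply: eq_bigr => m' _ /=.
under eq_bigr => c _ do rewrite mulrA -(chiD _ _ (root_pt_torus c wK)).
rewrite -mulr_suml sum_chi_root//; last first.
  move=> i; rewrite !mxE; have := nK i; have := ltn_ord (m i); have := ltn_ord (m' i).
  move: (n 0 i) (m i : nat) (m' i : nat) => x y z; lia.
have -> : (n + (box_pt m' - box_pt m) == 0) = (box_pt m - box_pt m' == n).
  by rewrite -opprB subr_eq0 eq_sym.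
by case: eqVneq => [->|_]; rewrite ?mul1r ?mul0r ?mulr0.
Qed.

(** Summing the hypothesis over roots of unity leaves the values p.2 p.1 with the
    weights [pair_count], and the weights divided by N^d tend to 1. *)
Lemma fejer_pos (s : seq ('rV[int]_d * ('rV[int]_d -> R[i]))) :
  (forall N l, torus l ->
     0 <= complex.Re (\sum_(p <- s) chi l p.1 * fejer_sum l N p.2)) ->
  0 <= complex.Re (\sum_(p <- s) p.2 p.1).
Proof.
move=> h.
have [D sD] : exists D : nat, forall p, p \in [seq q.1 | q <- s] -> forall i, (`|p 0%R i| <= D)%N.
  exists (\sum_(p <- [seq q.1 | q <- s]) \sum_i `|p 0%R i|)%N => p ps i.
  rewrite (big_rem _ ps) /= (bigD1 i)//= -addnA; exact: leq_addr.
(* K exceeds every coordinate of p.1 + m' - m, so nothing wraps around. *)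
have count_pos N : 0 <= \sum_(p <- s) (pair_count N p.1)%:R * complex.Re (p.2 p.1).
  pose K := (D + N).+1.
  have [w wK] := @prim_root_closed R[i] K isT.
  have : 0 <= \sum_(c : box K) complex.Re
      (\sum_(p <- s) chi (root_pt w c) p.1 * fejer_sum (root_pt w c) N p.2).
    by apply: sumr_ge0 => c _; exact/h/root_pt_torus.
  rewrite -Re_sum exchange_big /= (_ : \sum_(p <- s) _ =
      \sum_(p <- s) (K ^ d)%:R * ((pair_count N p.1)%:R * p.2 p.1)).
    rewrite -mulr_sumr mulr_natl ReMn pmulrn_lge0 ?expn_gt0//.
    rewrite Re_sum => le0; apply: le_trans le0 _; rewrite le_eqVlt.
    apply/orP; left; apply/eqP; apply: eq_bigr => p _.
    by rewrite mulr_natl ReMn mulr_natl.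
  rewrite !big_seq; apply: eq_bigr => p ps; apply: sum_fejer_root => // i.
  by rewrite /K leqW// leq_add2r sD// map_f.
pose A := \sum_(p <- s) `|complex.Re (p.2 p.1)|.
(* All weights lie between (N + 1)^d and (N + 1 + 2 D)^d for the box of side
   N + 1 enlarged by D on both sides. *)
have low N : - ((1 + 2 * D%:R / N.+1%:R) ^+ d - 1) * A <= complex.Re (\sum_(p <- s) p.2 p.1).
  have N0 : 0 < (N.+1%:R : R) ^+ d by rewrite exprn_gt0.
  have Mpow : N.+1%:R ^+ d * (1 + 2 * D%:R / N.+1%:R) ^+ d =
      ((D + (N.+1 + D)) ^ d)%:R :> R.
    rewrite natrX -exprMn !natrD; congr (_ ^+ _).
    by rewrite mulrDr mulr1 mulrC divfK ?pnatr_eq0//; ring.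
  rewrite -(ler_pM2l N0) Re_sum.
  have -> : N.+1%:R ^+ d * (- ((1 + 2 * D%:R / N.+1%:R) ^+ d - 1) * A) =
     - (((D + (N.+1 + D)) ^ d)%:R - N.+1%:R ^+ d) * A :> R by rewrite -Mpow; ring.
  rewrite mulNr lerNl -subr_ge0 opprK addrC.
  apply: le_trans (count_pos (D + (N.+1 + D))%N) _.
  rewrite /A !mulr_sumr -big_split /= !big_seq; apply: ler_sum => p ps.
  have lo := pair_count_ge N.+1 (sD _ (map_f _ ps)).
  have up := pair_count_le (D + (N.+1 + D)) p.1.
  move: lo up; rewrite -!(ler_nat R) [(N.+1 ^ d)%:R]natrX.
  set r := complex.Re _; set c := (pair_count _ _)%:R; set u := _%:R; set v := _ ^+ d.
  move=> lo up; have := ler_wpM2r (normr_ge0 r) up.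
  have : r * (c - v) <= `|r| * (c - v) by rewrite ler_wpM2r ?subr_ge0// ler_norm.
  nra.
have lim : (- ((1 + 2 * D%:R / N.+1%:R) ^+ d - 1) * A) @[N --> \oo] -->
    (- ((1 + 2 * D%:R * 0) ^+ d - 1) * A).
  apply: cvgMr_tmp; apply: cvgN; apply: cvgB; last exact: cvg_cst.
  apply: (cvg_comp _ (fun x => x ^+ d)); last exact: exprn_continuous.
  by apply: cvgD; [exact: cvg_cst | apply: cvgMl_tmp; exact: cvg_harmonic].
rewrite mulr0 addr0 expr1n subrr oppr0 mul0r in lim.
by apply: (cvgr_to_le lim); near=> N.
Unshelve. all: by end_near. Qed.

(** The Fejer kernel centred at l is a squared modulus, hence nonnegative. *)
Lemma fejer_kernel_sqr (l z : 'rV[R[i]]_d) N : torus l -> torus z ->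
  \sum_(m : box N) \sum_(m' : box N)
    chi l (box_pt m' - box_pt m) * chi z (box_pt m - box_pt m') =
  ((complex.Re `|\sum_(m : box N) Num.conj (chi l (box_pt m)) * chi z (box_pt m)|) ^+ 2)%:C.
Proof.
move=> lT zT; rewrite -conj_mul_norm rmorph_sum mulr_suml exchange_big.
apply: eq_bigr => m _; rewrite mulr_sumr; apply: eq_bigr => m' _ /=.
by rewrite !chiB// rmorphM /= conjCK; ring.
Qed.

End Characters.

(** * Laurent polynomials *)

Section Laurent.
Context {R : realType} {d : nat}.

(** Collecting the terms with equal exponents turns a list of monomials into a
    Laurent polynomial with the same value under every evaluation. *)
Lemma laurent_of_seq (L : seq (R[i] * 'rV[int]_d)) :
  exists p : laurent R d, forall (V : lmodType R[i]) (G : 'rV[int]_d -> V),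
    \sum_(n <- finsupp p) p n *: G n = \sum_(q <- L) q.1 *: G q.2.
Proof.
pose S := [fset n in [seq q.2 | q <- L]]%fset.
pose p : laurent R d := [fsfun n in S => \sum_(q <- L | q.2 == n) q.1].
exists p => V G.
have sub : (finsupp p `<=` S)%fset.
  by apply/fsubsetP => n; rewrite mem_finsupp fsfunE; case: ifP => //; rewrite eqxx.
rewrite (big_fset_incl _ sub) /=; last first.
  by move=> n _; rewrite memNfinsupp => /eqP ->; rewrite scale0r.
have pE n : n \in S -> p n *: G n = \sum_(q <- L | q.2 == n) q.1 *: G q.2.
  move=> nS; rewrite fsfunE nS scaler_suml.
  by apply: eq_bigr => q /eqP ->.
rewrite big_seq (eq_bigr _ pE) -big_seq (exchange_big_dep predT)//=.
rewrite !big_seq; apply: eq_bigr => q qL.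
have qS : q.2 \in S by rewrite in_fset /= map_f.
rewrite big_mkcond (bigD1_seq q.2 qS (fset_uniq S)) /= eqxx big1 ?addr0// => n nq.
by rewrite eq_sym (negPf nq).
Qed.

Lemma laurent_evalE (p : laurent R d) l : laurent_eval p l = \sum_(n <- finsupp p) p n * chi l n.
Proof. by []. Qed.

Lemma torus_nonempty : torus (const_mx 1 : 'rV[R[i]]_d).
Proof. by move=> i; rewrite mxE normr1. Qed.

Lemma laurent_sup_ub (p : laurent R d) l : torus l ->
  complex.Re `|laurent_eval p l| <= laurent_sup p.
Proof.
move=> lT; apply: ub_le_sup; last by exists l.
exists (\sum_(n <- finsupp p) complex.Re `|p n|) => _ [z zT <-].
rewrite laurent_evalE -Re_sum -lecR -norm_Re.
apply: le_trans (ler_norm_sum _ _ _) _.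
under eq_bigr do rewrite normrM chi_norm// mulr1.
rewrite [leLHS](_ : _ = (complex.Re (\sum_(n <- finsupp p) `|p n|))%:C)//.
by rewrite RRe_real// ger0_real// sumr_ge0.
Qed.

Lemma laurent_sup_le (p : laurent R d) M :
  (forall l, torus l -> complex.Re `|laurent_eval p l| <= M) -> laurent_sup p <= M.
Proof.
move=> h; apply: ge_sup => [|_ [l lT <-]]; last exact: h.
by exists (complex.Re `|laurent_eval p (const_mx 1)|), (const_mx 1) => //; exact: torus_nonempty.
Qed.

End Laurent.

(** * The regular pairs of a semigroup *)

Section Semigroup.
Context {R : realType} {d : nat} {H : hilbertType R}.
Variable T : 'rV[R]_d -> H -> H.
Hypothesis T_C0 : C0_semigroup T.

Lemma orthant_pos s : orthant (pos_part s : 'rV[R]_d).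
Proof. by move=> i; rewrite mxE le_max lexx orbT. Qed.
Lemma orthant_neg s : orthant (neg_part s : 'rV[R]_d).
Proof. by move=> i; rewrite mxE le_max lexx orbT. Qed.
Lemma pos_partN (s : 'rV[R]_d) : pos_part (- s) = neg_part s.
Proof. by apply/rowP => i; rewrite !mxE. Qed.
Lemma neg_partN (s : 'rV[R]_d) : neg_part (- s) = pos_part s.
Proof. by apply/rowP => i; rewrite !mxE opprK. Qed.
Lemma pos_part0 : pos_part (0 : 'rV[R]_d) = 0.
Proof. by apply/rowP => i; rewrite !mxE maxxx. Qed.
Lemma neg_part0 : neg_part (0 : 'rV[R]_d) = 0.
Proof. by apply/rowP => i; rewrite !mxE oppr0 maxxx. Qed.

Definition regular_pair (s : 'rV[R]_d) : H -> H :=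
  adjoint (T (neg_part s)) \o T (pos_part s).

Lemma T_bounded t : orthant t -> bounded_op (T t). Proof. by have [h _ _ _] := T_C0; exact: h. Qed.

Lemma regular_pair_bounded s : bounded_op (regular_pair s).
Proof.
apply: bounded_op_comp; last exact/T_bounded/orthant_pos.
exact/adjoint_bounded/T_bounded/orthant_neg.
Qed.

Lemma hdot_regular_pair s x y :
  hdot (regular_pair s x) y = hdot (T (pos_part s) x) (T (neg_part s) y).
Proof.
by rewrite hdotC -adjointP -?hdotC//; exact/T_bounded/orthant_neg.
Qed.

Lemma regular_pairN s x y :
  hdot (regular_pair (- s) x) y = Num.conj (hdot (regular_pair s y) x).
Proof. by rewrite !hdot_regular_pair pos_partN neg_partN -hdotC. Qed.

Lemma regular_pair0 : regular_pair 0 = id.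
Proof.
apply/funext => x; apply: hdot_inj => z; rewrite hdotC hdot_regular_pair.
by rewrite pos_part0 neg_part0; case: T_C0 => _ _ -> _; rewrite -hdotC.
Qed.

Lemma continuous_pos_part : continuous (@pos_part R d).
Proof.
have max_cont : continuous (fun a : R => Num.max a 0).
  by move=> a; apply: (continuous_max (f := id) (g := cst 0)); [exact: cvg_id|exact: cvg_cst].
move=> s B [P Ps PB]; exists (fun i j => [set a | P i j (Num.max a 0)]).
  move=> i j; apply: max_cont; have := Ps i j.
  by rewrite mxE ord1.
move=> u Pu; apply: PB => i j; rewrite mxE -(ord1 i); exact: Pu.
Qed.

Lemma continuous_T_pos x : continuous (fun s => T (pos_part s) x).
Proof.
have [_ /(_ x)/subspace_continuousP Tx _ _] := T_C0.
move=> s B /(Tx _ (orthant_pos s)) TB.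
have := continuous_pos_part TB; apply: (@filterS _ (nbhs s) (nbhs_filter s)) => u uB.
exact/uB/orthant_pos.
Qed.

Lemma continuous_regular_pair x y :
  continuous (fun s => complex.Re (hdot (regular_pair s x) y)).
Proof.
move=> s; under eq_fun do rewrite hdot_regular_pair.
apply: (@cvg_Re_hdot _ _ _ (nbhs s)); first exact: continuous_T_pos.
under eq_fun do rewrite -pos_partN; rewrite -pos_partN.
apply: (cvg_comp _ (fun u => T (pos_part u) y)); last exact: continuous_T_pos.
exact: oppr_continuous.
Qed.

Definition scaled_exponent (t : 'rV[R]_d) (n : 'rV[int]_d) : 'rV[R]_d :=
  \row_i ((n 0 i)%:~R * t 0 i).

Lemma orthant_delta i c : 0 <= c -> orthant (c *: delta_mx 0 i : 'rV[R]_d).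
Proof. by move=> c0 j; rewrite !mxE mulr_ge0. Qed.

Lemma orthantD (s t : 'rV[R]_d) : orthant s -> orthant t -> orthant (s + t).
Proof. by move=> s0 t0 i; rewrite mxE addr_ge0. Qed.

Lemma iter_marginal i c k : 0 <= c ->
  iter k (marginal T i c) = T ((k%:R * c) *: delta_mx 0 i).
Proof.
have [_ _ T0 TD] := T_C0; move=> c0; elim: k => [|k IH].
  by rewrite mul0r scale0r T0.
rewrite -add1n natrD mulrDl mul1r scalerDl TD -?IH//; apply: orthant_delta => //.
by rewrite mulr_ge0.
Qed.

Lemma big_comp_marginal (t : 'rV[R]_d) (P : pred 'I_d) (k : 'I_d -> nat) : orthant t ->
  \big[comp/id]_(i | P i) iter (k i) (marginal T i (t 0 i)) =
  T (\row_i (if P i then (k i)%:R * t 0 i else 0)).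
Proof.
have [_ _ T0 TD] := T_C0; move=> t0.
have E (r : seq 'I_d) : let v := \sum_(i <- r | P i) ((k i)%:R * t 0 i) *: delta_mx 0 i in
    orthant v /\ \big[comp/id]_(i <- r | P i) iter (k i) (marginal T i (t 0 i)) = T v.
  elim: r => [|i r [v0 IH]] /=.
    by rewrite !big_nil T0; split=> // i; rewrite mxE.
  rewrite !big_cons; case: ifP => // Pi.
  have o : orthant ((k i)%:R * t 0 i *: delta_mx 0 i) by apply: orthant_delta; rewrite mulr_ge0.
  by split; [exact: orthantD|rewrite IH iter_marginal// TD].
have [_ ->] := E (index_enum 'I_d); congr T.
apply/rowP => j; rewrite summxE mxE (big_mkcond P) (bigD1 j)//= big1 => [|i ij].
  by case: ifP => _; rewrite ?mxE ?eqxx ?mulr1 addr0.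
by case: ifP => // _; rewrite !mxE eq_sym (negPf ij) andbF mulr0.
Qed.

Lemma regular_monomialE (t : 'rV[R]_d) n : orthant t ->
  regular_monomial (fun i => marginal T i (t 0 i)) n = regular_pair (scaled_exponent t n).
Proof.
move=> t0; rewrite /regular_monomial /regular_pair !big_comp_marginal//.
congr (adjoint (T _) \o T _); apply/rowP => i; rewrite !mxE.
  case: ifPn => [ni|]; last rewrite -leNgt => ni.
    rewrite max_l; last by rewrite oppr_ge0 mulr_le0_ge0// lerz0 ltW.
    by rewrite -mulNr -mulrNz -(ltz0_abs ni) pmulrn.
  by rewrite max_r// oppr_le0 mulr_ge0// ler0z.
case: ifPn => [ni|]; last rewrite -leNgt => ni.
  rewrite max_l; last by rewrite mulr_ge0// ler0z ltW.
  by rewrite -[in RHS](gtz0_abs ni) pmulrn.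
by rewrite max_r// mulr_le0_ge0// lerz0.
Qed.

Section PolynomialBounds.
Variable t : 'rV[R]_d.
Hypotheses (t0 : orthant t) (T_bound : regular_poly_bound_at T t).
Local Notation F n := (regular_pair (scaled_exponent t n)).

Lemma scaled_exponent0 : scaled_exponent t 0 = 0.
Proof. by apply/rowP => i; rewrite !mxE mul0r. Qed.

Lemma regular_evalE (p : laurent R d) x :
  regular_eval p (fun i => marginal T i (t 0 i)) x = \sum_(n <- finsupp p) p n *: F n x.
Proof. by apply: eq_bigr => n _; rewrite regular_monomialE. Qed.

Lemma regular_eval_le (p : laurent R d) x :
  rnorm (\sum_(n <- finsupp p) p n *: F n x) <= laurent_sup p * rnorm x.
Proof.
rewrite -regular_evalE; apply: le_trans (rnorm_le_opnorm _ _) _.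
  have -> : regular_eval p (fun i => marginal T i (t 0 i)) =
      fun x => \sum_(n <- finsupp p) p n *: F n x by apply/funext => y; rewrite regular_evalE.
  by apply: bounded_op_sum => n; exact: regular_pair_bounded.
by rewrite ler_wpM2r ?rnorm_ge0.
Qed.

(** If 0 <= f <= M on the torus then |f - M/2| <= M/2 there, and the polynomial
    bound gives |f(T) y - (M/2) y| <= (M/2) |y|.  Pairing with y shows that
    Re <f(T) y, y> >= (M/2) |y|^2 - (M/2) |y|^2 = 0. *)
Lemma bound_positive (L : seq (R[i] * 'rV[int]_d)) (y : H) :
  (forall z, torus z -> exists2 r : R, 0 <= r & \sum_(q <- L) q.1 * chi z q.2 = r%:C) ->
  0 <= complex.Re (\sum_(q <- L) q.1 * hdot (F q.2 y) y).
Proof.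
move=> Lpos; pose M := \sum_(q <- L) complex.Re `|q.1|.
have [p pE] := laurent_of_seq ((- (M / 2)%:C, 0) :: L).
have sup_le : laurent_sup p <= M / 2.
  apply: laurent_sup_le => z zT; have [r r0 rE] := Lpos z zT.
  have -> : laurent_eval p z = (r - M / 2)%:C.
    rewrite laurent_evalE (pE R[i]^o (chi z)) big_cons /= [X in _ + X]rE chi0.
    by rewrite /GRing.scale /= mulr1 addrC rmorphB.
  rewrite normc_def /= expr0n addr0 sqrtr_sqr.
  have rM : r <= M.
    rewrite -[r]/(complex.Re r%:C) -rE Re_sum; apply: ler_sum => q _.
    by apply: le_trans (Re_le_norm _) _; rewrite normrM chi_norm// mulr1.
  by rewrite ler_norml; apply/andP; split; lra.
have := regular_eval_le p y.
rewrite (pE H (fun n => F n y)) big_cons /= scaled_exponent0 regular_pair0.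
set w := \sum_(q <- L) _ => wle.
have := Re_hdot_le (- (- (M / 2)%:C *: y + w)) y.
rewrite hdotNl ReN rnormN hdotDl ReD hdotZl mulNr ReN ReZ Re_hdot_self.
have -> : hdot w y = \sum_(q <- L) q.1 * hdot (F q.2 y) y.
  by rewrite /w hdot_suml; apply: eq_bigr => q _; rewrite hdotZl.
have := ler_wpM2r (rnorm_ge0 y) wle.
have := ler_wpM2r (rnorm_ge0 y) (ler_wpM2r (rnorm_ge0 y) sup_le).
rewrite -[_ / 2 * _ * _]mulrA -expr2; lra.
Qed.

Lemma hdot_chi_sum (A : H -> H) (s : seq ('rV[int]_d * H)) l : linear A -> torus l ->
  let y := \sum_(p <- s) chi l p.1 *: p.2 in
  hdot (A y) y = \sum_(p <- s) \sum_(q <- s) chi l (p.1 - q.1) * hdot (A p.2) q.2.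
Proof.
move=> Al lT /=.
have AD u v : A (u + v) = A u + A v by have := Al 1 u v; rewrite !scale1r.
have A0 : A 0 = 0 by have := Al (-1) 0 0; rewrite scaler0 addr0 scaleN1r addNr.
have AZ := scalable_linear Al.
rewrite (big_morph A AD A0) hdot_suml; apply: eq_bigr => p _.
rewrite hdot_sumr; apply: eq_bigr => q _.
by rewrite AZ /= hdotZl hdotZr chiB// mulrA.
Qed.

(** Fejer positivity reduces the claim to the Fejer sums.  Grouped by pairs of
    box points, these form <f(T) y, y>, where f is the Fejer kernel centred at l
    and y is the sum of the vectors p.2 weighted by the characters l^(p.1). *)
Lemma lattice_positive (s : seq ('rV[int]_d * H)) :
  0 <= complex.Re (\sum_(p <- s) \sum_(q <- s) hdot (F (p.1 - q.1) p.2) q.2).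
Proof.
pose S := [seq (p.1 - q.1, fun n => hdot (F n p.2) q.2) | p <- s, q <- s].
suff : 0 <= complex.Re (\sum_(x <- S) x.2 x.1) by rewrite /S big_allpairs_dep.
apply: fejer_pos => N l lT.
pose y := \sum_(p <- s) chi l p.1 *: p.2.
pose E := [seq (chi l (box_pt m' - box_pt m), box_pt m - box_pt m') |
       m : box N <- enum {: box N}, m' : box N <- enum {: box N}].
have sumE (a : R[i] -> 'rV[int]_d -> R[i]) : \sum_(e <- E) a e.1 e.2 =
    \sum_(m : box N) \sum_(m' : box N) a (chi l (box_pt m' - box_pt m)) (box_pt m - box_pt m').
  by rewrite big_allpairs_dep big_enum; apply: eq_bigr => m _; rewrite big_enum.
have -> : \sum_(x <- S) chi l x.1 * fejer_sum l N x.2 = \sum_(e <- E) e.1 * hdot (F e.2 y) y.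
  under eq_bigr do rewrite /fejer_sum -(sumE (fun c n => c * _ n)) mulr_sumr.
  rewrite exchange_big; apply: eq_bigr => e _ /=.
  rewrite hdot_chi_sum//; last by have [] := regular_pair_bounded (scaled_exponent t e.2).
  rewrite /S big_allpairs_dep mulr_sumr; apply: eq_bigr => p _ /=.
  by rewrite mulr_sumr; apply: eq_bigr => q _; rewrite mulrCA.
apply: bound_positive => z zT.
rewrite (sumE (fun c n => c * chi z n)) fejer_kernel_sqr//; eexists; last reflexivity.
exact: sqr_ge0.
Qed.

End PolynomialBounds.

(** The lattice of mesh 1 / (N + 1) approximates all points of R^d, and its step
    eventually lies in the neighbourhood on which the bounds hold.  Weak
    continuity of the regular pairs carries positivity over to R^d. *)
Lemma regular_pair_positive : regular_poly_bounds_near0 T ->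
  forall s : seq ('rV[R]_d * H),
  0 <= complex.Re (\sum_(p <- s) \sum_(q <- s) hdot (regular_pair (p.1 - q.1) p.2) q.2).
Proof.
move=> [W [_ Wnear Wbound]] s.
pose step (N : nat) : 'rV[R]_d := const_mx (harmonic N).
have step0 N : orthant (step N) by move=> i; rewrite mxE harmonic_ge0.
have stepW : \forall N \near \oo, W (step N).
  have c : step N @[N --> \oo] --> (0 : 'rV[R]_d).
    apply: cvg_rV => i; rewrite mxE.
    by under eq_fun do rewrite mxE; exact: cvg_harmonic.
  near=> N; suff : orthant (step N) -> W (step N) by apply; exact: step0.
  by near: N; exact: (c _ Wnear).
pose near_pt N (v : 'rV[R]_d) : 'rV[int]_d := \row_i Num.floor (v 0 i / harmonic N).
have near_ptP v w : scaled_exponent (step N) (near_pt N v - near_pt N w) @[N --> \oo] --> v - w.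
  have one u i : (near_pt N u 0 i)%:~R * harmonic N @[N --> \oo] --> u 0 i.
    apply/cvgrPdist_le => e e0; near=> N; rewrite mxE.
    have hN : harmonic N <= e :> R.
      by near: N; apply: (cvgr_le 0 cvg_harmonic).
    have h0 : 0 < harmonic N :> R by rewrite harmonic_gt0.
    apply: le_trans hN; have /andP[] := floor_itv (u 0 i / harmonic N).
    rewrite intrD ler_pdivlMr// ltr_pdivrMr// mulrDl mul1r => h1 h2.
    rewrite ger0_norm; lra.
  apply: cvg_rV => i.
  rewrite mxE [X in _ + X]mxE; under eq_fun do rewrite !mxE rmorphB mulrBl.
  by apply: cvgB; [have := one v i|have := one w i]; under eq_fun do rewrite mxE.
have lim : complex.Re (\sum_(p <- s) \sum_(q <- s) hdot (regular_pair (scaled_exponent (step N)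
     (near_pt N p.1 - near_pt N q.1)) p.2) q.2) @[N --> \oo] -->
   complex.Re (\sum_(p <- s) \sum_(q <- s) hdot (regular_pair (p.1 - q.1) p.2) q.2).
  rewrite Re_sum; under eq_fun do rewrite Re_sum.
  apply: cvg_big => [|p _]; first exact: add_continuous.
  rewrite Re_sum; under eq_fun do rewrite Re_sum.
  apply: cvg_big => [|q _]; first exact: add_continuous.
  apply: (cvg_comp _ (fun u => complex.Re (hdot (regular_pair u p.2) q.2)));
    [exact: near_ptP|exact: continuous_regular_pair].
apply: (cvgr_to_ge lim); apply: filterS stepW => N WN.
have := lattice_positive (step0 N) (Wbound _ WN) [seq (near_pt N p.1, p.2) | p <- s].
rewrite big_map; under eq_bigr do rewrite big_map.
by [].
Unshelve. all: by end_near. Qed.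

End Semigroup.

(** * From dilations to polynomial bounds *)

Section DilationToBounds.
Context {R : realType} {d : nat}.

Lemma scaled_exponentB (t : 'rV[R]_d) n m :
  scaled_exponent t (n - m) = scaled_exponent t n - scaled_exponent t m.
Proof. by apply/rowP => i; rewrite !mxE rmorphB mulrBl. Qed.

Section UnitaryRep.
Context {H : hilbertType R}.
Variable U : 'rV[R]_d -> H -> H.
Hypothesis U_rep : unitary_rep U.

Lemma unitary_rep_isometry s x y : hdot (U s x) (U s y) = hdot x y.
Proof.
have [/(_ s)[bU aU _] _ _ _] := U_rep.
by rewrite adjointP// -[adjoint (U s) (U s y)]/((adjoint (U s) \o U s) y) aU.
Qed.

Lemma unitary_rep_hdotB s t x : hdot (U (s - t) x) x = hdot (U s x) (U t x).
Proof.
have [_ _ _ UD] := U_rep.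
have E : s = t + (s - t) by rewrite addrC subrK.
by rewrite [in RHS]E [in RHS]UD /= unitary_rep_isometry.
Qed.

(** The Fejer sums of a(n) = <V^n v, v> are squared norms, and they stay
    nonnegative after multiplication by M^2 - |p(l)|^2.  Fejer positivity turns
    this into M^2 |v|^2 - |p(V) v|^2 >= 0. *)
Lemma unitary_von_neumann (p : laurent R d) (t : 'rV[R]_d) (v : H) :
  rnorm (\sum_(n <- finsupp p) p n *: U (scaled_exponent t n) v) <=
  laurent_sup p * rnorm v.
Proof.
set w := \sum_(n <- _) _; set M := laurent_sup p.
pose a n := hdot (U (scaled_exponent t n) v) v.
have aB n m : a (n - m) = hdot (U (scaled_exponent t n) v) (U (scaled_exponent t m) v).
  by rewrite /a scaled_exponentB unitary_rep_hdotB.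
have M0 : 0 <= M.
  by apply: le_trans (laurent_sup_ub p torus_nonempty); exact: Re_norm_ge0.
have fejerZ l N c : fejer_sum l N (fun n => c * a n) = c * fejer_sum l N a.
  rewrite /fejer_sum mulr_sumr; apply: eq_bigr => m _.
  by rewrite mulr_sumr; apply: eq_bigr => m' _; rewrite mulrCA.
have fejer_ge0 l N : torus l -> exists2 r : R, 0 <= r & fejer_sum l N a = r%:C.
  move=> lT; exists (rnorm (\sum_(m : box N) Num.conj (chi l (box_pt m)) *:
      U (scaled_exponent t (box_pt m)) v) ^+ 2); first exact: sqr_ge0.
  rewrite -hdot_self hdot_suml; apply: eq_bigr => m _.
  rewrite hdot_sumr; apply: eq_bigr => m' _.
  by rewrite hdotZl hdotZr conjCK chiB// aB; ring.
have := @fejer_pos R d ((0, fun n => (M ^+ 2)%:C * a n) ::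
  [seq (n - m, fun n' => - (p n * Num.conj (p m)) * a n') |
     n <- finsupp p, m <- finsupp p]).
have sumE : \sum_(n <- finsupp p) \sum_(m <- finsupp p) - (p n * Num.conj (p m)) * a (n - m) =
    - hdot w w.
  rewrite hdot_suml -sumrN; apply: eq_bigr => n _.
  rewrite hdot_sumr -sumrN; apply: eq_bigr => m _.
  by rewrite hdotZl hdotZr aB; ring.
rewrite big_cons big_allpairs_dep /= sumE ReD ReN ReZ Re_hdot_self.
have -> : a 0 = hdot v v.
  have -> : a 0 = hdot (U 0 v) v by rewrite /a scaled_exponent0.
  by have [_ _ -> _] := U_rep.
rewrite Re_hdot_self => key.
have : rnorm w ^+ 2 <= (M * rnorm v) ^+ 2.
  rewrite exprMn -subr_ge0; apply: key => N l lT.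
  have [r r0 rE] := fejer_ge0 l N lT.
  rewrite big_cons big_allpairs_dep /= chi0 mul1r fejerZ rE.
  have -> : \sum_(n <- finsupp p) \sum_(m <- finsupp p) chi l (n - m) *
      fejer_sum l N (fun n' => - (p n * Num.conj (p m)) * a n') =
      - ((complex.Re `|laurent_eval p l|) ^+ 2 * r)%:C.
    rewrite rmorphM /= -conj_mul_norm [Num.conj _ * _]mulrC laurent_evalE -mulrA.
    rewrite mulr_suml -sumrN; apply: eq_bigr => n _.
    rewrite rmorph_sum mulr_suml mulr_sumr -sumrN; apply: eq_bigr => m _ /=.
    by rewrite chiB// fejerZ rE rmorphM /=; ring.
  rewrite -rmorphM -rmorphB /= -mulrBl mulr_ge0// subr_ge0.
  by rewrite ler_sqr ?nnegrE ?Re_norm_ge0// laurent_sup_ub.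
by rewrite ler_sqr// nnegrE ?mulr_ge0 ?rnorm_ge0.
Qed.

End UnitaryRep.

(** With y = p(T) x one has |y|^2 = <p(V) r x, r y>, and r is isometric by the
    dilation identity at 0. *)
Lemma dilation_poly_bound (H : hilbertType R) (T : 'rV[R]_d -> H -> H) t :
  C0_semigroup T -> has_regular_unitary_dilation T -> orthant t ->
  regular_poly_bound_at T t.
Proof.
move=> T_C0 [H' [U [r [U_rep r_bd dil]]]] t0 p.
have dilE s x y : hdot (regular_pair T s x) y = hdot (U s (r x)) (r y).
  have -> : regular_pair T s x = adjoint r (U s (r x)) := congr1 (@^~ x) (dil s).
  by rewrite hdotC -(adjointP r_bd) -hdotC.
have r_iso x : rnorm (r x) = rnorm x.
  apply/eqP; rewrite -(@eqrXn2 _ 2)// ?rnorm_ge0//.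
  have := dilE 0 x x; rewrite regular_pair0//; case: (U_rep) => _ _ -> _.
  by rewrite !hdot_self => /complexI ->.
have M0 : 0 <= laurent_sup p.
  by apply: le_trans (laurent_sup_ub p torus_nonempty); exact: Re_norm_ge0.
apply: opnorm_le => x x1; rewrite regular_evalE//.
set y := \sum_(n <- _) _.
have : rnorm y ^+ 2 <= laurent_sup p * rnorm x * rnorm y.
  rewrite -Re_hdot_self {1}/y hdot_suml.
  under eq_bigr do rewrite hdotZl dilE -hdotZl.
  rewrite -hdot_suml -(r_iso y); apply: le_trans (Re_hdot_le _ _) _.
  by rewrite ler_wpM2r ?rnorm_ge0// -(r_iso x) unitary_von_neumann.
have [->|y0] := eqVneq (rnorm y) 0; first by [].
have yp : 0 < rnorm y by rewrite lt_def y0 rnorm_ge0.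
rewrite expr2 ler_pM2r// => /le_trans; apply.
by rewrite -[leRHS]mulr1 ler_wpM2l.
Qed.

End DilationToBounds.

(** * From positivity to dilations *)

Section Naimark.
Context {R : realType} {d : nat} {H : hilbertType R}.
Variable T : 'rV[R]_d -> H -> H.
Hypothesis T_C0 : C0_semigroup T.
Hypothesis T_pos : forall s : seq ('rV[R]_d * H),
  0 <= complex.Re (\sum_(p <- s) \sum_(q <- s) hdot (regular_pair T (p.1 - q.1) p.2) q.2).
Local Notation X := ('rV[R]_d * H)%type.

(** In any dilation this is <U(t) r y, U(s) r x>, with the arguments (s, x) and
    (t, y) in this order. *)
Definition shift_fun (x y : X) : R[i] := hdot (regular_pair T (y.1 - x.1) y.2) x.2.

Lemma shift_fun_sym x y : shift_fun y x = Num.conj (shift_fun x y).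
Proof. by rewrite /shift_fun -opprB regular_pairN. Qed.

Lemma regular_pairZ s a x : regular_pair T s (a *: x) = a *: regular_pair T s x.
Proof.
by have [/scalable_linear Al _] := regular_pair_bounded T_C0 s; exact: Al.
Qed.

Lemma shift_fun_psd (l : combo (R := R) (X := X)) : 0 <= complex.Re
  (\sum_(p <- l) \sum_(q <- l) Num.conj p.1 * (q.1 * shift_fun p.2 q.2)).
Proof.
have := T_pos [seq (p.2.1, p.1 *: p.2.2) | p <- l].
rewrite exchange_big big_map; under eq_bigr do rewrite big_map.
congr (0 <= complex.Re _); apply: eq_bigr => p _; apply: eq_bigr => q _ /=.
by rewrite regular_pairZ hdotZl hdotZr; ring.
Qed.

Definition shift_kernel := PsdKernel shift_fun_sym shift_fun_psd.
Local Notation K := (rkhs shift_kernel).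

Definition translate (a : 'rV[R]_d) (x : X) : X := (x.1 + a, x.2).

Lemma translateK a : cancel (translate a) (translate (- a)).
Proof. by move=> [s x]; rewrite /translate /= addrK. Qed.
Lemma translateNK a : cancel (translate (- a)) (translate a).
Proof. by move=> [s x]; rewrite /translate /= subrK. Qed.
Lemma shift_kernel_translate a x y :
  shift_kernel (translate a x) (translate a y) = shift_kernel x y.
Proof. by rewrite /= /shift_fun /= opprD addrACA subrr addr0. Qed.

Definition shift (a : 'rV[R]_d) : K -> K :=
  pullback (translateNK a) (shift_kernel_translate a).

Lemma shift0 : shift 0 = id.
Proof.
apply/funext => f; apply: val_inj; apply/funext => -[s x] /=.
by rewrite /translate /= oppr0 addr0.
Qed.

Lemma shiftD a b : shift (a + b) = shift a \o shift b.
Proof.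
apply/funext => f; apply: val_inj; apply/funext => -[s x] /=.
by rewrite /translate /= opprD addrA.
Qed.

Lemma shift_adjoint a : adjoint (shift a) = shift (- a).
Proof.
apply: adjoint_unique => f g.
rewrite -(hdot_pullback (translateK a) (translateNK a) (shift_kernel_translate a) f).
congr (hdot _ _); rewrite -[LHS]/(id g) -shift0 -(subrr a) shiftD.
by [].
Qed.

Lemma shift_unitary a : unitary_op (shift a).
Proof.
split.
- exact: (pullback_bounded (translateK a)).
- by rewrite shift_adjoint -shiftD addNr shift0.
- by rewrite shift_adjoint -shiftD subrr shift0.
Qed.

Lemma rnorm_shift a f : rnorm (shift a f) = rnorm f.
Proof. exact: (rnorm_pullback (translateK a)). Qed.

Lemma shift_kernel_at a t y : shift a (kernel_at shift_kernel (t, y)) =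
  kernel_at shift_kernel (t + a, y).
Proof.
apply: val_inj; apply/funext => -[s x].
rewrite -[LHS]/(kernel_at shift_kernel (t, y) (s - a, x)).
rewrite -[RHS]/(kernel_at shift_kernel (t + a, y) (s, x)) !kernel_atE /= /shift_fun /=.
by rewrite opprB addrA.
Qed.

Lemma shiftB a f g : shift a (f - g) = shift a f - shift a g.
Proof. exact: val_inj. Qed.

Lemma shift_synth a l : shift a (synth_rkhs shift_kernel l) =
  \sum_(p <- l) p.1 *: shift a (kernel_at shift_kernel p.2).
Proof.
rewrite synth_rkhsE; apply: (big_ind2 (fun u v => shift a u = v)) => [|u _ v _ <- <-|p _].
- exact: val_inj.
- exact: val_inj.
- exact: val_inj.
Qed.

(** If k is the kernel function at (t, y) and Phi(s) is the regular pair at s,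
    then |U(b) k - U(a) k|^2 = 2 (|y|^2 - Re <Phi(b - a) y, y>). *)
Lemma continuous_shift_kernel y : continuous (shift^~ (kernel_at shift_kernel y)).
Proof.
case: y => t y a; apply/(cvg_rnorm (nbhs_filter a)).
have E b : rnorm (shift b (kernel_at shift_kernel (t, y)) -
                  shift a (kernel_at shift_kernel (t, y))) =
    Num.sqrt (2 * (rnorm y ^+ 2 - complex.Re (hdot (regular_pair T (b - a) y) y))).
  rewrite -[LHS]ger0_norm ?rnorm_ge0// -sqrtr_sqr; congr Num.sqrt.
  rewrite !shift_kernel_at (rnormB_sqr (kernel_at shift_kernel (t + b, y))).
  rewrite -!Re_hdot_self !reproducing !kernel_atE /= /shift_fun /= !subrr regular_pair0//.
  by rewrite !Re_hdot_self opprD addrACA subrr add0r; ring.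
under eq_fun do rewrite E.
rewrite -(@sqrtr0 R) -(mulr0 2) -(subrr (rnorm y ^+ 2)).
have -> : rnorm y ^+ 2 = complex.Re (hdot (regular_pair T (a - a) y) y).
  by rewrite subrr regular_pair0// Re_hdot_self.
apply: (cvg_comp _ Num.sqrt); last exact: sqrt_continuous.
apply: cvgMl_tmp; apply: cvgB; first exact: cvg_cst.
apply: (cvg_comp _ (fun u => complex.Re (hdot (regular_pair T u y) y))).
  by apply: cvgB; [exact: cvg_id|exact: cvg_cst].
exact: continuous_regular_pair.
Qed.

(** Translations are isometric, so strong continuity passes from the span of the
    kernel functions to the whole space. *)
Lemma continuous_shift f : continuous (shift^~ f).
Proof.
move=> a; apply/(cvg_rnorm (nbhs_filter a)).
apply/(@cvgrPdist_lt _ _ _ (nbhs a) (nbhs_filter a)) => e e0.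
have e30 : 0 < e / 3 by rewrite divr_gt0.
have thirds (x y : R) : x < e / 3 -> y < e / 3 -> x + y + x < e by move=> *; lra.
have [l hl] := rkhs_span_dense f e30.
have lc : shift b (synth_rkhs shift_kernel l) @[b --> a] --> shift a (synth_rkhs shift_kernel l).
  rewrite shift_synth; under eq_fun do rewrite shift_synth.
  apply: (@cvg_big _ _ _ _ _ _ _ (nbhs a)) => [|p _]; first exact: add_continuous.
  by apply: cvgZl_tmp; exact: continuous_shift_kernel.
move: lc => /(cvg_rnorm (nbhs_filter a))/(@cvgrPdist_lt _ _ _ (nbhs a) (nbhs_filter a)).
move=> /(_ _ e30); apply: (@filterS _ (nbhs a) (nbhs_filter a)) => b.
rewrite !sub0r !normrN !ger0_norm ?rnorm_ge0// => bl.
have -> : shift b f - shift a f = shift b (f - synth_rkhs shift_kernel l) +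
   (shift b (synth_rkhs shift_kernel l) - shift a (synth_rkhs shift_kernel l)) -
   shift a (f - synth_rkhs shift_kernel l).
  by rewrite !shiftB addrA subrK opprB addrA subrK.
set u := f - _ in hl *; set v := shift b _ - _ in bl *.
apply: le_lt_trans (rnorm_leD _ _) _; rewrite rnormN rnorm_shift.
have uv : rnorm (shift b u + v) <= rnorm u + rnorm v.
  by apply: le_trans (rnorm_leD _ _) _; rewrite rnorm_shift.
apply: le_lt_trans (lerD uv (lexx _)) _.
exact: thirds hl bl.
Qed.

Lemma shift_rep : unitary_rep shift.
Proof.
split; [exact: shift_unitary|exact: continuous_shift|exact: shift0|].
by move=> a b; exact: shiftD.
Qed.

Definition embed (x : H) : K := kernel_at shift_kernel (0, x).

Lemma embed_bounded : bounded_op embed.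
Proof.
split.
  move=> a x y; apply: val_inj; apply/funext => z.
  rewrite -[LHS]/(embed (a *: x + y) z) -[RHS]/(a * embed x z + embed y z).
  rewrite !kernel_atE /= /shift_fun /=.
  have [Al _] := regular_pair_bounded T_C0 (0 - z.1).
  by rewrite Al hdotDl hdotZl.
exists 1 => x; rewrite mul1r -ler_sqr ?nnegrE ?rnorm_ge0//.
rewrite -Re_hdot_self reproducing kernel_atE /= /shift_fun /= subrr regular_pair0//.
by rewrite Re_hdot_self.
Qed.

Lemma shift_dilates t : regular_pair T t = adjoint embed \o shift t \o embed.
Proof.
apply/funext => x; apply: hdot_inj => z /=.
rewrite -(adjointP embed_bounded) hdotC [RHS]hdotC; congr Num.conj.
rewrite shift_kernel_at reproducing kernel_atE /= /shift_fun /=.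
by rewrite add0r subr0.
Qed.

Lemma positive_dilation : has_regular_unitary_dilation T.
Proof.
exists K, shift, embed; split; [exact: shift_rep|exact: embed_bounded|].
exact: shift_dilates.
Qed.

End Naimark.

Theorem theorem1p4 (R : realType) (d : nat) (d_gt0 : (0 < d)%N)
    (H : hilbertType R) (T : 'rV[R]_d -> H -> H)
    (T_C0 : C0_semigroup T) (T_gen : bounded_generators T) :
  [<-> has_regular_unitary_dilation T;
       regular_poly_bounds T;
       regular_poly_bounds_near0 T].
Proof.
tfae.
- by move=> dil t t0; exact: dilation_poly_bound.
- move=> bound; exists orthant; split=> //.
  by rewrite /within/=; near=> t.
- move=> bound; apply: positive_dilation => //.
  exact: regular_pair_positive.
Unshelve. all: by end_near. Qed.
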